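(* Let $\mathbf{p}=(p_0,\dots,p_n)\in(\mathbb{N}_{>0})^{n+1}$ be a sequence of well-formed weights and let $\mathbf{w}=(w_0,\dots,w_n)\in(\mathbb{N}_{>0})^{n+1}$. There exists a fibration $\pi_{\mathbf{p}}:\mathcal{Y}(\mathbf{p})\to\mathcal{C}(\mathbf{p})$ over a rational curve (with a distinguished point $0$), together with a function $f_{\mathbf{w}}:\mathcal{Y}(\mathbf{p})\to\mathbb{C}$, such that: (1) the generic fibre $\pi_{\mathbf{p}}^{-1}(t)$, $t\neq 0$, is isomorphic to the torus $x_0^{p_0}\cdots x_n^{p_n}=1$, and $f_{\mathbf{w}}$ is given by $x_0^{w_0}+\dots+x_n^{w_n}$ under this isomorphism; (2) there is a ring isomorphism $$T^1_{f_{\mathbf{w}}/\pi_{\mathbf{p}}}\simeq A^*_{\mathrm{orb}}(\mathcal{X}(\mathbf{w},\mathbf{p});\mathbb{C}),$$ where the left-hand side is the Jacobian algebra of $f_{\mathbf{w}}$ at the $0$-fibre of $\pi_{\mathbf{p}}$ and the right-hand side is the orbifold Chow ring of $\mathcal{X}(\mathbf{w},\mathbf{p})$ with complex coefficients.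
   Context: Well-formed: $\gcd(p_0,\dots,\widehat{p_i},\dots,p_n)=1$ for every $i\in\{0,\dots,n\}$ (the hat means omission). Fibration: here a flat morphism of affine schemes of finite type over $\mathbb{C}$. Jacobian algebra: let $\pi:\mathcal{Y}=\mathrm{Spec}\,R\to\mathcal{C}=\mathrm{Spec}\,A$ be a morphism, $0\in\mathcal{C}$ a distinguished closed point with maximal ideal $\mathfrak{m}_0\subset A$, and $f\in R$. Let $\Theta_\pi=\mathrm{Der}_A(R)$ be the $R$-module of $A$-linear derivations of $R$ (vector fields tangent to all the fibres of $\pi$), and let $\Theta_\pi(f)=\{D(f):D\in\Theta_\pi\}$, an ideal of $R$. The Jacobian algebra of $f$ at the $0$-fibre of $\pi$ is $T^1_{f/\pi}=R/(\mathfrak{m}_0R+\Theta_\pi(f))$. The toric orbifold $\mathcal{X}(\mathbf{w},\mathbf{p})$: let $N=\mathbb{Z}^{n+1}/\langle\sum_{i=0}^n p_i\mathbf{e}_i\rangle$ (free of rank $n$). Let $\Sigma$ be the simplicial fan in $N_{\mathbb{Q}}=N\otimes_{\mathbb{Z}}\mathbb{Q}$ whose cones are $\sigma_J=\{\sum_{j\in J}\lambda_j[\mathbf{e}_j]:\lambda_j\ge 0\}$ for $J\subsetneq\{0,\dots,n\}$, and let $\beta:\mathbb{Z}^{n+1}\to N$ be $\mathbf{e}_i\mapsto w_i[\mathbf{e}_i]$. Then $\mathcal{X}(\mathbf{w},\mathbf{p})$ is the smooth toric Deligne–Mumford stack over $\mathbb{C}$ associated (Borisov–Chen–Smith) with the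 stacky fan $(N,\Sigma,\beta)$. Its coarse moduli space is the weighted projective space $\mathbb{P}(\mathbf{p})$, the $w_i$ are the multiplicities of the toric divisors, and it is the $\mathbf{w}$-th root stack of $\mathbb{P}(\mathbf{p})$ along its coordinate divisors. Orbifold Chow ring: in the sense of Abramovich–Graber–Vistoli. Known description (Borisov–Chen–Smith): with rational coefficients it is isomorphic to $\mathbb{Q}[N]^\Sigma/\langle\xi_\theta(\sum_{i=0}^n y^{\beta(\mathbf{e}_i)}):\theta\in \mathrm{Hom}_{\mathbb{Z}}(N,\mathbb{Z})\rangle$. Here $\mathbb{Q}[N]^\Sigma$ is the vector space with basis $(y^c)_{c\in N}$ and product $y^{c_1}\cdot y^{c_2}=y^{c_1+c_2}$ if some cone of $\Sigma$ contains both $c_1$ and $c_2$, and $0$ otherwise, and $\xi_\theta(y^c)=\theta(c)y^c$.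
   Formalization: In (1), f_w corresponds on each fibre t≠0 to λ_t(x_0^{w_0}+…+x_n^{w_n}) with a constant λ_t≠0, and λ_t=1 for some t; λ_t=1 for all t is impossible for p=w=(1,1). The orbifold Chow ring is taken via its Borisov–Chen–Smith presentation. *)

(* Defs.v *)
From HB Require Import structures.
From mathcomp Require Import all_boot all_order all_algebra finmap.
From mathcomp Require Import monalg mpoly.
From mathcomp Require Import boolp reals complex.

Set Implicit Arguments.
Unset Strict Implicit.
Unset Printing Implicit Defensive.

Import Order.TTheory GRing.Theory Num.Theory.

Local Open Scope ring_scope.
Local Open Scope quotient_scope.

(* monalg rebinds this notation; restore multinomials' polynomial rings *)
Local Notation "{ 'mpoly' K [ n ] }" := (mpoly n K) : type_scope.

(* A closed point of Spec A is given by its maximal ideal, and an ideal by its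
   membership predicate. *)
Definition is_ideal (A : comPzRingType) (I : A -> Prop) : Prop :=
  [/\ I 0, forall x y, I x -> I y -> I (x + y) & forall a x, I x -> I (a * x)].

Definition maximal_ideal (A : comPzRingType) (m : A -> Prop) : Prop :=
  [/\ is_ideal m, ~ m 1 &
      forall I : A -> Prop, is_ideal I -> (forall x, m x -> I x) -> ~ I 1 ->
        forall x, I x -> m x].

Definition generated_ideal (A : comPzRingType) (S : A -> Prop) (x : A) : Prop :=
  exists (k : nat) (a s : 'I_k -> A),
    (forall i, S (s i)) /\ x = \sum_(i < k) a i * s i.

Section Quotient.
Variables (K : comNzRingType) (A : comAlgType K) (S : A -> Prop).

Definition ideal_pred : {pred A} := fun x => `[< generated_ideal S x >].

Lemma ideal_predP x : reflect (generated_ideal S x) (x \in ideal_pred).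
Proof. exact: asboolP. Qed.

Lemma ideal_predMl a x : x \in ideal_pred -> a * x \in ideal_pred.
Proof.
move=> /ideal_predP [k [b [s [Ss ->]]]]; apply/ideal_predP.
exists k, (fun i => a * b i), s; split=> //.
by rewrite mulr_sumr; apply: eq_bigr => i _; rewrite mulrA.
Qed.

Lemma ideal_predMr a x : x \in ideal_pred -> x * a \in ideal_pred.
Proof. by rewrite mulrC; apply: ideal_predMl. Qed.

Lemma ideal_predZ (c : K) x : x \in ideal_pred -> c *: x \in ideal_pred.
Proof. by move=> Sx; rewrite -mulr_algl; apply: ideal_predMl. Qed.

Lemma ideal_pred_zmod : zmod_closed ideal_pred.
Proof.
split.
  apply/ideal_predP; exists 0, (fun _ => 0), (fun _ => 0).
  by split=> [[]|]//; rewrite big_ord0.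
move=> x y /ideal_predP [k [b [s [Ss ->]]]] /ideal_predP [l [c [t [Tt ->]]]].
apply/ideal_predP; exists (k + l)%N,
  (fun i => match split i with inl i => b i | inr i => - c i end),
  (fun i => match split i with inl i => s i | inr i => t i end).
split=> [i|]; first by case: (split i).
rewrite big_split_ord /= -sumrN; congr (_ + _); apply: eq_bigr => i _.
  by rewrite -[lshift _ _]/(unsplit (inl i)) unsplitK.
by rewrite -[rshift _ _]/(unsplit (inr i)) unsplitK mulNr.
Qed.

HB.instance Definition _ := GRing.isZmodClosed.Build A ideal_pred ideal_pred_zmod.

(* A / (S).  Unlike MathComp's [{ideal_quot _}], the ideal may be the unit
   ideal, and the quotient keeps its [K]-module structure. *)
Definition quotient_alg : Type := @Quotient.quot A ideal_pred.
Local Notation Q := quotient_alg.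

HB.instance Definition _ := GRing.Zmodule.on Q.
HB.instance Definition _ := Quotient.on Q.

Definition class_of (x : A) : Q := \pi_Q x.

Lemma class_ofP x y : class_of x = class_of y <-> x - y \in ideal_pred.
Proof. by rewrite Quotient.idealrBE; split=> [/eqP|] // H; apply/eqP. Qed.

Lemma class_ofK (q : Q) : class_of (repr q) = q.
Proof. exact: reprK. Qed.

Lemma class_ofD x y : class_of (x + y) = class_of x + class_of y.
Proof. by rewrite /class_of; apply: (@Quotient.pi_add _ ideal_pred). Qed.

Lemma repr_class x : repr (class_of x) - x \in ideal_pred.
Proof. by apply/class_ofP; rewrite class_ofK. Qed.

Definition quotient_mul (q r : Q) : Q := class_of (repr q * repr r).
Definition quotient_scale (c : K) (q : Q) : Q := class_of (c *: repr q).

Lemma class_ofM x y : quotient_mul (class_of x) (class_of y) = class_of (x * y).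
Proof.
apply/class_ofP.
rewrite (_ : _ - _ = (repr (class_of x) - x) * repr (class_of y)
                     + x * (repr (class_of y) - y)).
  by apply: rpredD; [apply: ideal_predMr|apply: ideal_predMl]; apply: repr_class.
by rewrite mulrBl mulrBr addrA subrK.
Qed.

Lemma class_ofZ c x : quotient_scale c (class_of x) = class_of (c *: x).
Proof. by apply/class_ofP; rewrite -scalerBr; apply/ideal_predZ/repr_class. Qed.

Local Notation lift q := (esym (class_ofK q)).

Lemma quotient_mulA : associative quotient_mul.
Proof.
by move=> x y z; rewrite (lift x) (lift y) (lift z) !class_ofM mulrA.
Qed.

Lemma quotient_mulC : commutative quotient_mul.
Proof. by move=> x y; rewrite /quotient_mul mulrC. Qed.

Lemma quotient_mul1 : left_id (class_of 1) quotient_mul.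
Proof. by move=> x; rewrite (lift x) class_ofM mul1r. Qed.

Lemma quotient_mulDl : left_distributive quotient_mul +%R.
Proof.
move=> x y z; rewrite (lift x) (lift y) (lift z).
by rewrite -class_ofD !class_ofM -class_ofD mulrDl.
Qed.

Lemma quotient_mulDr : right_distributive quotient_mul +%R.
Proof.
by move=> x y z; rewrite quotient_mulC quotient_mulDl !(quotient_mulC x).
Qed.

Lemma quotient_mulr1 : right_id (class_of 1) quotient_mul.
Proof. by move=> x; rewrite quotient_mulC quotient_mul1. Qed.

HB.instance Definition _ := GRing.Zmodule_isPzRing.Build Q
  quotient_mulA quotient_mul1 quotient_mulr1 quotient_mulDl quotient_mulDr.
HB.instance Definition _ := GRing.PzRing_hasCommutativeMul.Build Q quotient_mulC.

Lemma quotient_scaleA a b q :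
  quotient_scale a (quotient_scale b q) = quotient_scale (a * b) q.
Proof. by rewrite (lift q) !class_ofZ scalerA. Qed.

Lemma quotient_scale1 : left_id 1 quotient_scale.
Proof. by move=> q; rewrite (lift q) class_ofZ scale1r. Qed.

Lemma quotient_scaleDr : right_distributive quotient_scale +%R.
Proof.
move=> a x y; rewrite (lift x) (lift y) -class_ofD !class_ofZ -class_ofD.
by rewrite scalerDr.
Qed.

Lemma quotient_scaleDl q : {morph quotient_scale^~ q : a b / a + b}.
Proof. by move=> a b; rewrite (lift q) !class_ofZ scalerDl class_ofD. Qed.

HB.instance Definition _ := GRing.Zmodule_isLmodule.Build K Q
  quotient_scaleA quotient_scale1 quotient_scaleDr quotient_scaleDl.

End Quotient.

Arguments class_of {K A} S x.

Definition alg_isomorphism (K : comNzRingType) (A B : comAlgType K)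
    (S : A -> Prop) (T : B -> Prop)
    (phi : {rmorphism quotient_alg S -> quotient_alg T}) : Prop :=
  bijective phi /\ scalable phi.

Definition finite_type (K : comNzRingType) (A : comAlgType K) : Prop :=
  exists (k : nat) (g : {lrmorphism {mpoly K[k]} -> A}),
    forall a : A, exists q, g q = a.

Section Morphism.
Variables (K : comNzRingType) (A B : comAlgType K) (pi : {lrmorphism A -> B}).

(* [B] is an [A]-module through [pi]. *)
Definition bilinear_map (N P : lmodType A) (b : N -> B -> P) : Prop :=
  [/\ forall x y r, b (x + y) r = b x r + b y r,
      forall x r s, b x (r + s) = b x r + b x s,
      forall a x r, b (a *: x) r = a *: b x r
    & forall a x r, b x (pi a * r) = a *: b x r].

(* [\sum_i x i (x) r i = 0] in the tensor product of [N] and [B] over [A]: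
   by the universal property, every bilinear map kills it. *)
Definition tensor_eq0 (N : lmodType A) (k : nat) (x : 'I_k -> N) (r : 'I_k -> B)
    : Prop :=
  forall (P : lmodType A) (b : N -> B -> P),
    bilinear_map b -> \sum_(i < k) b (x i) (r i) = 0.

Definition flat : Prop :=
  forall (N' N : lmodType A) (iota : {linear N' -> N}), injective iota ->
    forall (k : nat) (x : 'I_k -> N') (r : 'I_k -> B),
      tensor_eq0 (fun i => iota (x i)) r -> tensor_eq0 x r.

Definition fibration : Prop := [/\ finite_type A, finite_type B & flat].

(* The ideal of [B] generated by this set is m B. *)
Definition pulled_back (m : A -> Prop) (x : B) : Prop :=
  exists2 a, m a & x = pi a.

Definition fibre (m : A -> Prop) := quotient_alg (pulled_back m).

Definition relative_derivation (D : B -> B) : Prop :=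
  [/\ forall x y, D (x + y) = D x + D y,
      forall x y, D (x * y) = x * D y + D x * y
    & forall a x, D (pi a * x) = pi a * D x].

Definition Theta_at (f x : B) : Prop :=
  exists2 D, relative_derivation D & x = D f.

Definition jacobian_gens (m0 : A -> Prop) (f x : B) : Prop :=
  pulled_back m0 x \/ Theta_at f x.

(* m_0 B + Theta(f) is the ideal generated by [jacobian_gens m0 f]. *)
Definition jacobian_algebra (m0 : A -> Prop) (f : B) :=
  quotient_alg (jacobian_gens m0 f).

End Morphism.

(* Spec A is an affine integral curve with Frac A isomorphic to K(X) over K. *)
Definition rational_curve (K : fieldType) (A : comAlgType K) : Prop :=
  finite_type A /\
  exists iota : {rmorphism A -> {fraction {poly K}}},
    [/\ injective iota,
        forall c : K, iota c%:A = tofrac c%:P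
      & forall z, exists a b : A, iota b != 0 /\ z = iota a / iota b].

Definition well_formed (n : nat) (p : 'I_n.+1 -> nat) : Prop :=
  forall i, \big[gcdn/0%N]_(j | j != i) p j = 1%N.

Definition torus_eq (K : comNzRingType) (n : nat) (p : 'I_n.+1 -> nat)
    (q : {mpoly K[n.+1]}) : Prop :=
  q = \prod_i 'X_i ^+ p i - 1.

Definition torus_alg (K : comNzRingType) (n : nat) (p : 'I_n.+1 -> nat) :=
  quotient_alg (@torus_eq K n p).

Definition power_sum (K : comNzRingType) (n : nat) (p w : 'I_n.+1 -> nat)
    : torus_alg K p :=
  class_of (@torus_eq K n p) (\sum_i 'X_i ^+ w i).

(* The fibre of [pi] over [m] is isomorphic to the torus x^p = 1, with [f]
   corresponding to [lam] times x_0^{w_0} + ... + x_n^{w_n}.  For lam <> 0 and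
   K algebraically closed, rescaling each x_i by a w_i-th root of lam turns
   this into f = x_0^{w_0} + ... + x_n^{w_n} on a translate x^p = u of the
   torus. *)
Definition fibre_is_torus (K : comNzRingType) (A B : comAlgType K)
    (pi : {lrmorphism A -> B}) (n : nat) (p w : 'I_n.+1 -> nat) (f : B)
    (m : A -> Prop) (lam : K) : Prop :=
  exists phi : {rmorphism fibre pi m -> torus_alg K p},
    alg_isomorphism phi /\ phi (class_of _ f) = lam *: power_sum K p w.

Section Lattice.
Variables (K : comNzRingType) (n : nat) (p : 'I_n.+1 -> nat).

Definition weight_row : 'rV[K]_n.+1 := \row_i (p i)%:R.

Definition weight_line : {pred 'rV[K]_n.+1} :=
  fun v => `[< exists k : K, v = k *: weight_row >].

Lemma weight_line_zmod : zmod_closed weight_line.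
Proof.
split; first by apply/asboolP; exists 0; rewrite scale0r.
move=> x y /asboolP [a ->] /asboolP [b ->].
by apply/asboolP; exists (a - b); rewrite scalerBl.
Qed.

HB.instance Definition _ :=
  GRing.isZmodClosed.Build 'rV[K]_n.+1 weight_line weight_line_zmod.

(* K^{n+1} / K p : the lattice N for K = int; N (x) Q for K = rat *)
Definition quot_lattice : Type := @Quotient.quot 'rV[K]_n.+1 weight_line.

HB.instance Definition _ := GRing.Zmodule.on quot_lattice.
HB.instance Definition _ := Quotient.on quot_lattice.

Definition lattice_class (v : 'rV[K]_n.+1) : quot_lattice := \pi_quot_lattice v.

Lemma lattice_classP u v :
  lattice_class u = lattice_class v <-> exists k : K, u - v = k *: weight_row.
Proof.
split=> [/eqP|H]; first by rewrite -Quotient.idealrBE => /asboolP.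
by apply/eqP; rewrite -Quotient.idealrBE; apply/asboolP.
Qed.

Lemma lattice_classK c : lattice_class (repr c) = c.
Proof. exact: reprK. Qed.

Lemma lattice_classD u v :
  lattice_class (u + v) = lattice_class u + lattice_class v.
Proof. exact: (@Quotient.pi_add _ weight_line). Qed.

Lemma lattice_class0 : lattice_class 0 = 0.
Proof.
by apply: (addrI (lattice_class 0)); rewrite -lattice_classD !addr0.
Qed.

Definition ray (i : 'I_n.+1) : quot_lattice := lattice_class (delta_mx 0 i).

End Lattice.

Section Fan.
Variables (n : nat) (p : 'I_n.+1 -> nat).

Definition Nlat := quot_lattice int p.

Definition to_NQ (c : Nlat) : quot_lattice rat p :=
  lattice_class p (map_mx intr (repr c)).

Definition in_cone (J : {set 'I_n.+1}) (c : Nlat) : Prop :=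
  exists lam : 'I_n.+1 -> rat,
    (forall j, 0 <= lam j) /\
    to_NQ c = lattice_class p (\sum_(j in J) lam j *: delta_mx 0 j).

Definition share_cone (c1 c2 : Nlat) : Prop :=
  exists2 J : {set 'I_n.+1}, J \proper [set: 'I_n.+1] &
    in_cone J c1 /\ in_cone J c2.

Definition beta (w : 'I_n.+1 -> nat) (v : 'rV[int]_n.+1) : Nlat :=
  \sum_i ray int p i *~ (v 0 i * (w i)%:Z).

End Fan.

Section FanProperty.
Variables (n : nat) (p : 'I_n.+1 -> nat) (p_gt0 : forall i, (0 < p i)%N).
Local Notation N := (Nlat p).

(* c lies in the maximal cone whose generators are the [ray i], i != j *)
Definition in_facet (j : 'I_n.+1) (c : N) : Prop :=
  forall i, (repr c) 0 j * (p i)%:Z <= (repr c) 0 i * (p j)%:Z.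

Lemma repr_lattice_class (v : 'rV[int]_n.+1) :
  exists k : int, forall i, (repr (lattice_class p v)) 0 i = v 0 i + k * (p i)%:Z.
Proof.
have /lattice_classP [k Hk] := lattice_classK (lattice_class p v).
exists k => i; have /matrixP /(_ 0 i) := Hk.
by rewrite !mxE natz => /(canRL (subrK _)) ->; rewrite addrC.
Qed.

Lemma in_facet_class j v :
  in_facet j (lattice_class p v) <->
  forall i, v 0 j * (p i)%:Z <= v 0 i * (p j)%:Z.
Proof.
rewrite /in_facet; have [k E] := repr_lattice_class v.
by split=> H i; have := H i; rewrite !E !mulrDl -!mulrA
  [(p j)%:Z * _]mulrC lerD2r.
Qed.

Lemma in_facet_add_class j c1 c2 :
  in_facet j (c1 + c2) <->
  forall i, (repr c1 + repr c2) 0 j * (p i)%:Z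
              <= (repr c1 + repr c2) 0 i * (p j)%:Z.
Proof.
rewrite -in_facet_class lattice_classD.
by split; rewrite !lattice_classK.
Qed.

Lemma in_facetD j c1 c2 :
  in_facet j c1 -> in_facet j c2 -> in_facet j (c1 + c2).
Proof.
move=> F1 F2; apply/in_facet_add_class => i.
by rewrite !mxE !mulrDl lerD.
Qed.

Lemma in_facetDl j k c1 c2 : in_facet j c1 -> in_facet j c2 ->
  in_facet k (c1 + c2) -> in_facet k c1.
Proof.
move=> F1 F2 /in_facet_add_class /(_ j); rewrite !mxE !mulrDl => F.
have E1 := F1 k; have E2 := F2 k.
have Ek : (repr c1) 0 k * (p j)%:Z = (repr c1) 0 j * (p k)%:Z.
  apply/le_anti/andP; split=> //.
  by rewrite -(lerD2r ((repr c2) 0 j * (p k)%:Z)) (le_trans _ F) ?lerD2l.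
move=> i; have pj : 0 < (p j)%:Z by rewrite ltz_nat p_gt0.
rewrite -(ler_pM2r pj) mulrAC Ek mulrAC [X in _ <= X]mulrAC.
by rewrite ler_wpM2r ?F1.
Qed.

Lemma in_facetDr j k c1 c2 : in_facet j c1 -> in_facet j c2 ->
  in_facet k (c1 + c2) -> in_facet k c2.
Proof. by rewrite addrC => F1 F2; apply: in_facetDl F1. Qed.

Lemma in_facet_ex c : exists j, in_facet j c.
Proof.
pose r i : rat := ((repr c) 0 i)%:~R / (p i)%:R.
case: (@arg_minP _ rat _ ord0 predT r isT) => j _ Hj.
exists j => i; have := Hj i isT; rewrite /r.
have pp k : (0 : rat) < (p k)%:R by rewrite ltr0n p_gt0.
rewrite ler_pdivrMr // mulrAC ler_pdivlMr //.
by rewrite !pmulrn -!intrM ler_int.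
Qed.

Lemma in_cone_facet (J : {set 'I_n.+1}) j c :
  in_cone J c -> j \notin J -> in_facet j c.
Proof.
move=> [lam [lam0]] /lattice_classP [k /matrixP E] jJ.
have {}E i : ((repr c) 0 i)%:~R = (if i \in J then lam i else 0) + k * (p i)%:R.
  have := E 0 i; rewrite !mxE => /(canRL (subrK _)) ->; rewrite addrC.
  congr (_ + _); rewrite summxE; case: ifPn => iJ.
    rewrite (bigD1 i) //= !mxE !eqxx mulr1 big1 ?addr0 // => l /andP [_ li].
    by rewrite !mxE (negPf (_ : i != l)) ?mulr0 // eq_sym.
  rewrite big1 // => l lJ; rewrite !mxE (negPf (_ : i != l)) ?mulr0 //.
  by apply: contraNneq iJ => ->.
move=> i; rewrite -(ler_int rat) !intrM (E j) (E i) (negPf jJ) add0r.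
rewrite mulrDl -!pmulrn -!mulrA [X in k * X]mulrC lerDr mulr_ge0 ?ler0n //.
by case: ifP.
Qed.

Lemma in_facet_cone j c : in_facet j c -> in_cone (~: [set j]) c.
Proof.
move=> F; pose k : rat := ((repr c) 0 j)%:~R / (p j)%:R.
have pj : (0 : rat) < (p j)%:R by rewrite ltr0n p_gt0.
pose lam i : rat := ((repr c) 0 i)%:~R - k * (p i)%:R.
exists lam; split=> [i|].
  rewrite subr_ge0 /k mulrAC ler_pdivrMr //.
  by rewrite !pmulrn -!intrM ler_int; apply: F.
apply/lattice_classP; exists k; apply/matrixP => a i; rewrite ord1 {a}.
rewrite !mxE summxE.
suff -> : \sum_(l in ~: [set j]) (lam l *: delta_mx 0 l : 'rV[rat]_n.+1) 0 i
          = lam i by rewrite opprB addrC subrK.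
have [->|ij] := eqVneq i j.
  rewrite big1 => [|l]; last first.
    by rewrite !inE => lj; rewrite !mxE eq_sym (negPf lj) mulr0.
  by rewrite /lam /k divfK ?subrr // gt_eqF.
rewrite (bigD1 i) ?inE //= big1 ?addr0 => [|l /andP [_ li]].
  by rewrite !mxE !eqxx mulr1.
by rewrite !mxE eq_sym (negPf li) mulr0.
Qed.

Lemma share_coneP c1 c2 :
  share_cone c1 c2 <-> exists j, in_facet j c1 /\ in_facet j c2.
Proof.
split=> [[J /properP [_ [j _ jJ]] [C1 C2]]|[j [F1 F2]]].
  by exists j; split; apply: in_cone_facet jJ.
exists (~: [set j]); last by split; apply: in_facet_cone.
by apply/properP; split=> //; exists j; rewrite ?inE ?eqxx.
Qed.

Lemma share_coneC (c1 c2 : N) : `[< share_cone c1 c2 >] = `[< share_cone c2 c1 >].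
Proof. by apply/asboolP/asboolP => -[J pJ [C1 C2]]; exists J. Qed.

Lemma share_cone0 (c : N) : share_cone 0 c.
Proof.
have [j Fj] := in_facet_ex c; apply/share_coneP; exists j; split=> //.
by rewrite -lattice_class0; apply/in_facet_class => i; rewrite !mxE !mul0r.
Qed.

Lemma share_coneA (c1 c2 c3 : N) :
  `[< share_cone c1 c2 >] && `[< share_cone (c1 + c2) c3 >]
  = `[< share_cone c2 c3 >] && `[< share_cone c1 (c2 + c3) >].
Proof.
apply/andP/andP => -[/asboolP /share_coneP [j [F1 F2]]
                     /asboolP /share_coneP [k [F3 F4]]].
  have G1 := in_facetDl F1 F2 F3; have G2 := in_facetDr F1 F2 F3.
  by split; apply/asboolP/share_coneP; exists k; split=> //; apply: in_facetD.
have G1 := in_facetDl F1 F2 F4; have G2 := in_facetDr F1 F2 F4.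
by split; apply/asboolP/share_coneP; exists k; split=> //; apply: in_facetD.
Qed.

End FanProperty.

(* [msupp], [mcoeff] and [g@_c] now refer to monalg rather than to mpoly *)
Import monalg.
Local Notation "g @_ c" := (monalg.mcoeff c g) : ring_scope.

Lemma malgUZ (T : choiceType) (K : comNzRingType) (a b : K) (c : T) :
  a *: << b *g c >> = << a * b *g c >> :> {malg K[T]}.
Proof. by apply/malgP => c'; rewrite mcoeffZ !mcoeffU mulrnAr. Qed.

(* a y^c.  Locked, like [fan_mul], because unification otherwise unfolds the
   finitely supported functions underneath. *)
HB.lock Definition mono (K : comNzRingType) (n : nat) (p : 'I_n.+1 -> nat)
    (a : K) (c : Nlat p) : {malg K[Nlat p]} := << a *g c >>.

Lemma monoE (K : comNzRingType) (n : nat) (p : 'I_n.+1 -> nat) (a : K)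
  (c : Nlat p) : mono a c = << a *g c >>.
Proof. by rewrite mono.unlock. Qed.

Definition fan_term (K : comNzRingType) (n : nat) (p : 'I_n.+1 -> nat)
    (c1 c2 : Nlat p) (a b : K) : {malg K[Nlat p]} :=
  if `[< share_cone c1 c2 >] then mono (a * b) (c1 + c2) else 0.

HB.lock Definition fan_mul (K : comNzRingType) (n : nat) (p : 'I_n.+1 -> nat)
    (g h : {malg K[Nlat p]}) : {malg K[Nlat p]} :=
  \sum_(c1 <- msupp g) \sum_(c2 <- msupp h) fan_term c1 c2 g@_c1 h@_c2.

Section FanAlgebra.
Variables (K : comNzRingType) (n : nat) (p : 'I_n.+1 -> nat).
Variable p_gt0 : forall i, (0 < p i)%N.
Local Notation N := (Nlat p).

(* Sigma is a fan, and the product of [fan_mul] associative, because of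
   [p_gt0]. *)
Definition fan_alg of (forall i, (0 < p i)%N) : Type := {malg K[N]}.
Local Notation S := (fan_alg p_gt0).
Local Notation fan_mul := (@fan_mul K n p).

HB.instance Definition _ := GRing.Lmodule.on S.

Implicit Types (g h : {malg K[N]}) (c : N) (a b : K).

Lemma fan_term0l c1 c2 b : fan_term c1 c2 0 b = 0.
Proof. by rewrite /fan_term monoE mul0r monalgU0 if_same. Qed.

Lemma fan_term0r c1 c2 a : fan_term c1 c2 a 0 = 0.
Proof. by rewrite /fan_term monoE mulr0 monalgU0 if_same. Qed.

Lemma fan_termDl c1 c2 a a' b :
  fan_term c1 c2 (a + a') b = fan_term c1 c2 a b + fan_term c1 c2 a' b.
Proof.
rewrite /fan_term; case: `[< share_cone c1 c2 >]; last by rewrite addr0.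
by rewrite mulrDl !monoE monalgUD.
Qed.

Lemma fan_mulEw (d1 d2 : {fset N}) g h :
  (msupp g `<=` d1)%fset -> (msupp h `<=` d2)%fset ->
  fan_mul g h = \sum_(c1 <- d1) \sum_(c2 <- d2) fan_term c1 c2 g@_c1 h@_c2.
Proof.
move=> s1 s2; rewrite fan_mul.unlock (big_fset_incl _ s1) /=; last first.
  move=> c1 _ c1g; rewrite big1 // => c2 _.
  by rewrite (mcoeff_outdom c1g) fan_term0l.
apply: eq_bigr => c1 _; rewrite (big_fset_incl _ s2) //= => c2 _ c2h.
by rewrite (mcoeff_outdom c2h) fan_term0r.
Qed.

Lemma fan_mulC : commutative fan_mul.
Proof.
move=> g h; rewrite fan_mul.unlock exchange_big /=.
apply: eq_bigr => c1 _; apply: eq_bigr => c2 _.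
by rewrite /fan_term share_coneC mulrC addrC.
Qed.

Lemma fan_mulDl : left_distributive fan_mul +%R.
Proof.
move=> g g' h; pose d := (msupp g `|` msupp g')%fset.
have s1 : (msupp g `<=` d)%fset by rewrite fsubsetUl.
have s2 : (msupp g' `<=` d)%fset by rewrite fsubsetUr.
rewrite (fan_mulEw (msuppD_le g g') (fsubset_refl (msupp h))).
rewrite (fan_mulEw s1 (fsubset_refl _)) (fan_mulEw s2 (fsubset_refl _)).
rewrite -big_split /=; apply: eq_bigr => c1 _.
rewrite -big_split /=; apply: eq_bigr => c2 _.
by rewrite mcoeffD fan_termDl.
Qed.

Lemma fan_mulDr : right_distributive fan_mul +%R.
Proof. by move=> g h h'; rewrite fan_mulC fan_mulDl !(fan_mulC g). Qed.

Lemma fan_mul0 g : fan_mul 0 g = 0.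
Proof. by rewrite fan_mul.unlock msupp0 big_nil. Qed.

Lemma fan_mulr0 g : fan_mul g 0 = 0.
Proof. by rewrite fan_mulC fan_mul0. Qed.

Lemma fan_alg_ind (P : {malg K[N]} -> Prop) :
  P 0 -> (forall g h, P g -> P h -> P (g + h)) ->
  (forall a c, P (mono a c)) -> forall g, P g.
Proof.
move=> P0 PD PU g; rewrite (monalgE g); elim: (enum_fset _) => [|c r IH].
  by rewrite big_nil.
by rewrite big_cons; apply: PD IH; rewrite -monoE; apply: PU.
Qed.

Lemma fan_mulU c1 c2 a b :
  fan_mul (mono a c1) (mono b c2) = fan_term c1 c2 a b.
Proof.
have E (x : K) (c : N) : (msupp (mono x c) `<=` [fset c])%fset by rewrite monoE msuppU_le.
by rewrite (fan_mulEw (E a c1) (E b c2)) !big_seq_fset1 !monoE !mcoeffUU.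
Qed.

Lemma fan_mulA_mono c1 c2 c3 a b (d : K) :
  fan_mul (mono a c1) (fan_mul (mono b c2) (mono d c3))
  = fan_mul (fan_mul (mono a c1) (mono b c2)) (mono d c3).
Proof.
rewrite !fan_mulU /fan_term.
have := share_coneA p_gt0 c1 c2 c3.
case: `[< share_cone c1 c2 >]; case: `[< share_cone c2 c3 >] => /= E.
- by rewrite (fan_mulU c1) (fan_mulU (c1 + c2)) /fan_term E mulrA addrA.
- by rewrite fan_mulr0 (fan_mulU (c1 + c2)) /fan_term E.
- by rewrite fan_mul0 (fan_mulU c1) /fan_term -E.
- by rewrite fan_mul0 fan_mulr0.
Qed.

Lemma fan_mulA : associative fan_mul.
Proof.
move=> x y z; elim/fan_alg_ind: x => [|x x' IH IH'|a c1].
- by rewrite !fan_mul0.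
- by rewrite !fan_mulDl IH IH'.
elim/fan_alg_ind: y => [|y y' IH IH'|b c2].
- by rewrite fan_mul0 fan_mulr0 fan_mul0.
- by rewrite fan_mulDl !fan_mulDr fan_mulDl IH IH'.
elim/fan_alg_ind: z => [|z z' IH IH'|d c3].
- by rewrite !fan_mulr0.
- by rewrite !fan_mulDr IH IH'.
exact: fan_mulA_mono.
Qed.

Definition fan_one : S := mono 1 0.

Lemma fan_mul1 : left_id fan_one fan_mul.
Proof.
elim/fan_alg_ind => [|x y IH IH'|a c].
- by rewrite fan_mulr0.
- by rewrite fan_mulDr IH IH'.
rewrite fan_mulU /fan_term asboolT; last exact: share_cone0.
by rewrite mul1r add0r.
Qed.

Lemma fan_one_neq0 : fan_one != 0.
Proof. by rewrite /fan_one monoE monalgU_eq0 oner_neq0. Qed.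

HB.instance Definition _ := GRing.Zmodule_isComNzRing.Build S
  fan_mulA fan_mulC fan_mul1 fan_mulDl fan_one_neq0.

Lemma monoZ a b c : a *: mono b c = mono (a * b) c.
Proof. by rewrite !monoE; apply: malgUZ. Qed.

Lemma fan_mulZ a g h : a *: fan_mul g h = fan_mul (a *: g) h.
Proof.
rewrite (fan_mulEw (msuppZ_le a g) (fsubset_refl _)) fan_mul.unlock scaler_sumr.
apply: eq_bigr => c1 _; rewrite scaler_sumr; apply: eq_bigr => c2 _.
rewrite mcoeffZ /fan_term; case: `[< share_cone c1 c2 >].
  by rewrite monoZ mulrA.
by rewrite scaler0.
Qed.

Lemma fan_scaleAl a (g h : S) : a *: (g * h) = (a *: g) * h.
Proof. exact: fan_mulZ. Qed.

HB.instance Definition _ := GRing.Lmodule_isLalgebra.Build K S fan_scaleAl.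
HB.instance Definition _ := GRing.Lalgebra_isComAlgebra.Build K S.

Definition xi (theta : {additive N -> int}) (g : S) : S :=
  \sum_(c <- msupp g) mono ((theta c)%:~R * g@_c) c.

Definition orb_chow_gens (w : 'I_n.+1 -> nat) (x : S) : Prop :=
  exists theta : {additive N -> int},
    x = xi theta (\sum_i mono 1 (beta p w (delta_mx 0 i))).

(* The orbifold Chow ring of X(w, p) with coefficients in K, by the
   Borisov-Chen-Smith presentation K[N]^Sigma / (xi_theta (\sum_i y^(beta e_i)))
   for the stacky fan (N, Sigma, beta). *)
Definition orb_chow (w : 'I_n.+1 -> nat) := quotient_alg (orb_chow_gens w).

End FanAlgebra.

(* Main.v *)
Require Import Defs.
From HB Require Import structures.
From mathcomp Require Import all_boot all_order all_algebra.
From mathcomp Require Import ssrcomplements finmap mpoly zify ring.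
From mathcomp Require Import boolp reals complex.

Set Implicit Arguments.
Unset Strict Implicit.
Unset Printing Implicit Defensive.

Import Order.TTheory GRing.Theory Num.Theory.
Local Open Scope ring_scope.

Local Notation "{ 'mpoly' K [ n ] }" := (mpoly n K) : type_scope.

(** Put d = p_0 ... p_n and q_i = d / p_i.  The total space is the spectrum of
    the subalgebra B of K[z_0, ..., z_n] spanned by the monomials z^a for which
    some integer k satisfies a_i = k mod q_i for all i.  The fibration is
    t = z_0 ... z_n, a map to the affine line, and the function is
    f = x_0^w_0 + ... + x_n^w_n with x_i = z_i^q_i.  Geometrically B is the
    normal toric degeneration attached to the fan Sigma: the exponents of B are
    the lattice points of the positive orthant in Z^{n+1} + Z (p / d), written
    in rescaled coordinates.

    Every exponent of B is uniquely a multiple of (1, ..., 1) plus an exponent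
    with a vanishing coordinate, so B is free over K[t] (base_map_flat).

    The product of the x_i^p_i is t^d.  Away from t = 0 one can invert t and
    recover every z^a from the x_i and t, because an exponent a of B becomes a
    combination of the exponents of the x_i after adding a multiple of
    (1, ..., 1).  Thus the fibre over tau <> 0 is x^p = tau^d (fibre_torus), and
    rescaling the coordinates by constants c_i whose c_i^w_i all agree turns it
    into x^p = 1 while multiplying f by a constant (torus_scaling).

    Writing a_i = q_i v_i + k sends the exponents of B onto the lattice
    N = Z^{n+1} / Z p, and adding (1, ..., 1) does not change the class.  The
    exponents with a vanishing coordinate therefore represent N exactly once,
    and two of them lie in a common cone of Sigma exactly when they vanish at a
    common coordinate, that is, when their product is not divisible by t.
    Hence B / t B is the fan algebra K[N]^Sigma (central_eq0, central_surj).

    It remains to see that the vector fields along the fibres are logarithmic.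
    A linear form theta on N gives the Euler field z^a |-> theta(a) z^a, whose
    value at f restricts to xi_theta (sum_i y^(beta e_i)) on the central fibre
    (euler_potential).  Conversely a K[t]-linear derivation D kills
    t^d = x^p, so sum_j p_j D(x_j) / x_j = 0; multiplying by x_0 ... x_n and
    comparing the coordinates of exponents shows that x_j divides D(x_j) in B
    (coord_dvd_deriv).  With D(x_j) = x_j b_j and sum_j p_j b_j = 0, D(f) is a
    combination of the values of the Euler fields at f.  So the Jacobian ideal is
    the preimage of the ideal of the Borisov-Chen-Smith presentation
    (central_ideal). *)

(** * Linear extension from monomials and evaluation of polynomials *)

Section LinearExtension.
Variables (K : comNzRingType) (n : nat) (V : lmodType K).
Variable chi : 'X_{1..n} -> V.

Definition lin_ext (g : {mpoly K[n]}) : V := \sum_(a <- msupp g) g@_a *: chi a.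

(** A common finite range of summation, which makes additivity visible. *)
Lemma lin_extEw k g : (msize g <= k)%N ->
  lin_ext g = \sum_(a : 'X_{1..n < k}) g@_a *: chi a.
Proof.
move=> le_gk; rewrite /lin_ext (big_mksub 'X_{1..n < k}) ?msupp_uniq //=; first last.
  by move=> m /msize_mdeg_lt /leq_trans; apply.
rewrite big_rmcond //= => m /memN_msupp_eq0 ->.
by rewrite scale0r.
Qed.

Lemma lin_ext_linear : linear lin_ext.
Proof.
move=> c g h; pose k := maxn (msize (c *: g + h)) (maxn (msize g) (msize h)).
rewrite !(@lin_extEw k) ?leq_max ?leqnn ?orbT //.
rewrite scaler_sumr -big_split; apply: eq_bigr => a _ /=.
by rewrite mcoeffD mcoeffZ scalerDl scalerA.
Qed.

HB.instance Definition _ :=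
  GRing.isLinear.Build K {mpoly K[n]} V _ lin_ext lin_ext_linear.

Lemma lin_extX a : lin_ext 'X_[a] = chi a.
Proof. by rewrite /lin_ext msuppX big_seq1 mcoeffX eqxx scale1r. Qed.

End LinearExtension.

Lemma lin_ext_functional (K : comNzRingType) (n : nat) (V : lmodType K)
    (chi : 'X_{1..n} -> V) (phi : V -> K) (g : {mpoly K[n]}) :
  (forall x y, phi (x + y) = phi x + phi y) -> (forall c x, phi (c *: x) = c * phi x) ->
  phi (lin_ext chi g) = \sum_(a <- msupp g) g@_a * phi (chi a).
Proof.
move=> phiD phiZ; have phi0 : phi 0 = 0 by rewrite -(scale0r 0) phiZ mul0r.
by rewrite /lin_ext (big_morph _ phiD phi0); apply: eq_bigr => a _; apply: phiZ.
Qed.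

Section Eval.
Variables (K : comNzRingType) (B : comAlgType K) (k : nat) (h : 'I_k -> B).

Definition alg_eval : {mpoly K[k]} -> B := mmap (in_alg B) h.

Lemma alg_eval_scalable : scalable alg_eval.
Proof. by move=> c x; rewrite /alg_eval mmapZ mulr_algl. Qed.

HB.instance Definition _ := GRing.RMorphism.on alg_eval.
HB.instance Definition _ := GRing.isScalable.Build K _ _ _ alg_eval alg_eval_scalable.

Lemma alg_evalD : {morph alg_eval : x y / x + y}.
Proof. exact: rmorphD. Qed.

Lemma alg_evalM : {morph alg_eval : x y / x * y}.
Proof. exact: rmorphM. Qed.

Lemma alg_evalX a : alg_eval 'X_[a] = \prod_i h i ^+ a i.
Proof. exact: mmapX. Qed.

Lemma alg_evalXi i : alg_eval 'X_i = h i.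
Proof. by rewrite /alg_eval mmapX mmap1U. Qed.

End Eval.

(** * Monomial algebras cut out by congruences *)

Section CongruenceAlgebra.
Variables (K : comNzRingType) (n : nat) (q : 'I_n -> nat).

(** The remainder modulo the q i is recorded by the k to be added, rather than
    subtracted, so that it stays a natural number. *)
Definition shiftable (a : 'X_{1..n}) (k : nat) := [forall i, (q i %| a i + k)%N].

Definition cong_mnm (a : 'X_{1..n}) : bool := `[< exists k, shiftable a k >].

Implicit Types (a b : 'X_{1..n}) (k l : nat).

Lemma shiftableP a k : reflect (forall i, (q i %| a i + k)%N) (shiftable a k).
Proof. exact: forallP. Qed.

Lemma cong_mnmP a : reflect (exists k, shiftable a k) (cong_mnm a).
Proof. exact: asboolP. Qed.

Lemma shiftableD a b k l :
  shiftable a k -> shiftable b l -> shiftable (a + b)%MM (k + l).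
Proof.
move=> /shiftableP ak /shiftableP bl; apply/shiftableP => i.
by rewrite mnmDE addnACA dvdn_add.
Qed.

Lemma cong_mnm0 : cong_mnm 0%MM.
Proof. by apply/cong_mnmP; exists 0; apply/shiftableP => i; rewrite mnm0E. Qed.

Lemma cong_mnmD a b : cong_mnm a -> cong_mnm b -> cong_mnm (a + b)%MM.
Proof.
move=> /cong_mnmP[k ak] /cong_mnmP[l bl]; apply/cong_mnmP.
by exists (k + l)%N; apply: shiftableD.
Qed.

Definition cong_poly : {pred {mpoly K[n]}} := fun g => all cong_mnm (msupp g).

Lemma cong_polyP g :
  reflect (forall a, a \in msupp g -> cong_mnm a) (g \in cong_poly).
Proof. exact: allP. Qed.

Lemma cong_polyX a : cong_mnm a -> 'X_[a] \in cong_poly.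
Proof. by move=> Ma; apply/cong_polyP => b; rewrite msuppX inE => /eqP ->. Qed.

Lemma cong_poly_subalg : GRing.subsemialg_closed cong_poly.
Proof.
split.
- by rewrite -[1]mpolyX0; apply/cong_polyX/cong_mnm0.
- split; first by apply/cong_polyP => a; rewrite msupp0.
  move=> g h /cong_polyP Mg /cong_polyP Mh; apply/cong_polyP => a /msuppD_le.
  by rewrite mem_cat => /orP[/Mg|/Mh].
- by move=> c g /cong_polyP Mg; apply/cong_polyP => a /msuppZ_le /Mg.
- move=> g h /cong_polyP Mg /cong_polyP Mh; apply/cong_polyP => a /msuppM_le.
  by case/allpairsP => -[b c] /= [/Mg Mb /Mh Mc ->]; apply: cong_mnmD.
Qed.

HB.instance Definition _ :=
  GRing.isSubalgClosed.Build K {mpoly K[n]} cong_poly cong_poly_subalg.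

Record cong_alg := CongAlg { cong_val : {mpoly K[n]}; _ : cong_val \in cong_poly }.

HB.instance Definition _ := [isSub for cong_val].
HB.instance Definition _ := [Choice of cong_alg by <:].
HB.instance Definition _ := [SubChoice_isSubComNzRing of cong_alg by <:].
HB.instance Definition _ := [SubZmodule_isSubLmodule of cong_alg by <:].
HB.instance Definition _ := [SubNzRing_SubLmodule_isSubLalgebra of cong_alg by <:].
HB.instance Definition _ := [SubLalgebra_isSubAlgebra of cong_alg by <:].

Lemma cong_valZ (c : K) (x : cong_alg) : val (c *: x) = c *: val x.
Proof. exact: linearZ. Qed.

Lemma cong_valM (x y : cong_alg) : val (x * y) = val x * val y.
Proof. exact: rmorphM. Qed.

Lemma cong_valD (x y : cong_alg) : val (x + y) = val x + val y.
Proof. exact: raddfD. Qed.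

Lemma cong_val1 : val (1 : cong_alg) = 1.
Proof. exact: rmorph1. Qed.

Lemma cong_val_sum (I : Type) (r : seq I) (P : pred I) (F : I -> cong_alg) :
  val (\sum_(i <- r | P i) F i) = \sum_(i <- r | P i) val (F i).
Proof. exact: raddf_sum. Qed.

(** Total in [a]: outside the congruence monoid it takes the default value 0. *)
Definition cong_mono (a : 'X_{1..n}) : cong_alg := insubd 0 'X_[a].

Lemma cong_val_mono a : cong_mnm a -> val (cong_mono a) = 'X_[a].
Proof. by move=> Ma; rewrite insubdK //; apply: cong_polyX. Qed.

Lemma cong_monoD a b : cong_mnm a -> cong_mnm b ->
  cong_mono (a + b)%MM = cong_mono a * cong_mono b.
Proof.
move=> Ma Mb; apply: val_inj.
by rewrite cong_valM !cong_val_mono ?cong_mnmD // mpolyXD.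
Qed.

Lemma cong_mono0 : cong_mono 0%MM = 1.
Proof. by apply: val_inj; rewrite cong_val_mono ?cong_mnm0 // mpolyX0 cong_val1. Qed.

Lemma cong_mnmMn a k : cong_mnm a -> cong_mnm (a *+ k)%MM.
Proof.
move=> Ma; elim: k => [|k Mk]; first by rewrite mulm0n cong_mnm0.
by rewrite mulmS cong_mnmD.
Qed.

Lemma cong_monoX a k : cong_mnm a -> cong_mono a ^+ k = cong_mono (a *+ k)%MM.
Proof.
move=> Ma; elim: k => [|k IHk]; first by rewrite mulm0n cong_mono0.
by rewrite exprS IHk mulmS cong_monoD ?cong_mnmMn.
Qed.

Lemma cong_mono_prod (I : Type) (r : seq I) (F : I -> 'X_{1..n}) :
  (forall i, cong_mnm (F i)) ->
  \prod_(i <- r) cong_mono (F i) = cong_mono (\sum_(i <- r) F i)%MM.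
Proof.
move=> MF; suff [] : cong_mnm (\sum_(i <- r) F i)%MM /\
    \prod_(i <- r) cong_mono (F i) = cong_mono (\sum_(i <- r) F i)%MM by [].
elim: r => [|i r [Mr IHr]]; first by rewrite !big_nil cong_mono0 cong_mnm0.
by rewrite !big_cons IHr cong_monoD ?cong_mnmD.
Qed.

Lemma cong_alg_monoE (x : cong_alg) :
  x = \sum_(a <- msupp (val x)) (val x)@_a *: cong_mono a.
Proof.
apply: val_inj; rewrite cong_val_sum [LHS]mpolyE big_seq [RHS]big_seq.
apply: eq_bigr => a ax; rewrite cong_valZ cong_val_mono //.
by move: a ax; apply/cong_polyP/valP.
Qed.

Lemma cong_alg_ind (P : cong_alg -> Prop) : P 0 ->
  (forall c a x, cong_mnm a -> P x -> P (c *: cong_mono a + x)) -> forall x, P x.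
Proof.
move=> P0 PD x; rewrite (cong_alg_monoE x).
have /cong_polyP := valP x; elim: (msupp _) => [|a s IHs] Ms.
  by rewrite big_nil.
rewrite big_cons; apply: PD; first by apply: Ms; rewrite mem_head.
by apply: IHs => b bs; apply: Ms; rewrite inE bs orbT.
Qed.

End CongruenceAlgebra.

(** * Ideals and isomorphisms of quotient algebras *)

Section GeneratedIdeal.
Variable A : comPzRingType.
Implicit Types (S T : A -> Prop) (a x y : A).

Lemma generated_ideal_gen S x : S x -> generated_ideal S x.
Proof.
by move=> Sx; exists 1, (fun=> 1), (fun=> x); rewrite big_ord1 mul1r.
Qed.

Lemma generated_ideal0 S : generated_ideal S 0.
Proof. by exists 0, (fun=> 0), (fun=> 0); split=> [[]|]//; rewrite big_ord0. Qed.

Lemma generated_idealD S x y :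
  generated_ideal S x -> generated_ideal S y -> generated_ideal S (x + y).
Proof.
move=> [k [b [s [Ss ->]]]] [l [c [t [Tt ->]]]]; exists (k + l)%N,
  (fun i => match split i with inl i => b i | inr i => c i end),
  (fun i => match split i with inl i => s i | inr i => t i end).
split=> [i|]; first by case: (split i).
rewrite big_split_ord /=; congr (_ + _); apply: eq_bigr => i _.
  by rewrite -[lshift _ _]/(unsplit (inl i)) unsplitK.
by rewrite -[rshift _ _]/(unsplit (inr i)) unsplitK.
Qed.

Lemma generated_idealMl S a x : generated_ideal S x -> generated_ideal S (a * x).
Proof.
move=> [k [b [s [Ss ->]]]]; exists k, (fun i => a * b i), s; split=> //.
by rewrite mulr_sumr; apply: eq_bigr => i _; rewrite mulrA.
Qed.

Lemma generated_idealB S x y :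
  generated_ideal S x -> generated_ideal S y -> generated_ideal S (x - y).
Proof.
by move=> Sx Sy; apply: generated_idealD => //; rewrite -mulN1r; apply: generated_idealMl.
Qed.

Lemma generated_ideal_sum S (I : Type) (r : seq I) (P : pred I) (F : I -> A) :
  (forall i, P i -> generated_ideal S (F i)) ->
  generated_ideal S (\sum_(i <- r | P i) F i).
Proof.
by move=> SF; apply: big_ind => //; [apply: generated_ideal0|apply: generated_idealD].
Qed.

Lemma generated_ideal_sub S (I : A -> Prop) : I 0 ->
  (forall x y, I x -> I y -> I (x + y)) -> (forall a x, S x -> I (a * x)) ->
  forall x, generated_ideal S x -> I x.
Proof. by move=> I0 ID IS x [k [b [s [Ss ->]]]]; elim/big_ind: _ => // i _; apply: IS. Qed.

End GeneratedIdeal.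

Section QuotientIso.
Variables (K : comNzRingType) (A B : comAlgType K).
Variables (S : A -> Prop) (T : B -> Prop) (g : {lrmorphism A -> B}).
Hypothesis g_ideal : forall x, generated_ideal T (g x) <-> generated_ideal S x.
Hypothesis g_surj : forall y, exists x, generated_ideal T (y - g x).

Lemma class_of0P (C : comAlgType K) (U : C -> Prop) x y :
  class_of U x = class_of U y <-> generated_ideal U (x - y).
Proof. by rewrite class_ofP; split=> /ideal_predP. Qed.

Definition quot_map (z : quotient_alg S) : quotient_alg T := class_of T (g (repr z)).

Lemma quot_map_class x : quot_map (class_of S x) = class_of T (g x).
Proof.
apply/class_of0P; rewrite -raddfB; apply/g_ideal.
by apply/class_of0P; rewrite class_ofK.
Qed.

Lemma quot_map_zmod : zmod_morphism quot_map.
Proof.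
move=> x y; apply: (addIr (quot_map y)); rewrite subrK.
rewrite -(class_ofK x) -(class_ofK y).
have -> : class_of S (repr x) - class_of S (repr y) = class_of S (repr x - repr y).
  by apply: (addIr (class_of S (repr y))); rewrite subrK -class_ofD subrK.
by rewrite !quot_map_class -class_ofD raddfB subrK.
Qed.

Lemma quot_map_monoid : monoid_morphism quot_map.
Proof.
split=> [|x y]; first by rewrite [LHS]quot_map_class rmorph1.
rewrite -(class_ofK x) -(class_ofK y).
rewrite [X in quot_map X](class_ofM S) !quot_map_class rmorphM.
by rewrite [RHS](class_ofM T).
Qed.

Lemma quot_map_scalable : scalable quot_map.
Proof.
move=> c x; rewrite -(class_ofK x).
have -> : c *: class_of S (repr x) = class_of S (c *: repr x) := class_ofZ S c _.
by rewrite !quot_map_class linearZ; apply/esym/(class_ofZ T).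
Qed.

HB.instance Definition _ := GRing.isZmodMorphism.Build _ _ quot_map quot_map_zmod.
HB.instance Definition _ := GRing.isMonoidMorphism.Build _ _ quot_map quot_map_monoid.

(** Surjectivity is asked for modulo T, because the algebra map from the
    polynomial ring of the torus that is used below hits a function only up to
    the ideal of a fibre. *)
Lemma quot_map_iso :
  exists phi : {rmorphism quotient_alg S -> quotient_alg T},
    alg_isomorphism phi /\ forall x, phi (class_of S x) = class_of T (g x).
Proof.
exists quot_map; split; last exact: quot_map_class.
split; last exact: quot_map_scalable.
exists (fun y => class_of S (sval (cid (g_surj (repr y))))) => [x|y].
  case: cid => x' /= gx'; rewrite -(class_ofK x); apply/class_of0P/g_ideal.
  rewrite raddfB; apply/class_of0P; rewrite -[RHS]quot_map_class class_ofK.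
  by rewrite -[RHS](class_ofK (quot_map x)); apply/esym/class_of0P.
by case: cid => x /= gx; rewrite quot_map_class -[RHS](class_ofK y); apply/esym/class_of0P.
Qed.

End QuotientIso.

Lemma alg_isomorphism_inv (K : comNzRingType) (A B : comAlgType K)
    (S : A -> Prop) (T : B -> Prop)
    (phi : {rmorphism quotient_alg S -> quotient_alg T}) :
  alg_isomorphism phi ->
  exists psi : {rmorphism quotient_alg T -> quotient_alg S},
    alg_isomorphism psi /\ cancel phi psi.
Proof.
case=> -[psi phiK psiK] phiZ.
have psi_zmod : zmod_morphism psi.
  by move=> x y; apply: (can_inj phiK); rewrite raddfB /= !psiK.
have psi_monoid : monoid_morphism psi.
  by split=> [|x y]; apply: (can_inj phiK); rewrite ?rmorph1 ?rmorphM /= !psiK.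
pose psiB := GRing.isZmodMorphism.Build _ _ psi psi_zmod.
pose psiM := GRing.isMonoidMorphism.Build _ _ psi psi_monoid.
pose psiR : {rmorphism _ -> _} := HB.pack psi psiB psiM.
exists psiR; split=> //; split=> [|c y]; first by exists phi.
by apply: (can_inj phiK); rewrite phiZ /= !psiK.
Qed.

(** * Flatness from coordinates *)

(** The coordinates and the family e form a dual basis, so B is projective over
    A.  The coordinate c turns into the bilinear map (y, s) |-> coord c s *: y,
    and applying all of them to a relation that holds after the injection shows
    that it holds coordinate by coordinate before.  The expansion of x is asked
    for over all large enough index lists, so that finitely many elements can be
    expanded over one common list. *)
Lemma coordinates_flat (K : comNzRingType) (A B : comAlgType K)
    (pi : {lrmorphism A -> B}) (C : eqType) (e : C -> B) (coord : C -> B -> A) :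
  (forall c x y, coord c (x + y) = coord c x + coord c y) ->
  (forall c a x, coord c (pi a * x) = a * coord c x) ->
  (forall x, exists s : seq C, forall s' : seq C, uniq s' -> {subset s <= s'} ->
     x = \sum_(c <- s') pi (coord c x) * e c) ->
  flat pi.
Proof.
move=> coordD coordZ coordE N' N iota iota_inj k x r iota_eq0.
have coord_eq0 c : \sum_(i < k) coord c (r i) *: x i = 0.
  apply: iota_inj; rewrite raddf0 raddf_sum.
  rewrite -[RHS](iota_eq0 N (fun y s => coord c s *: y)); last first.
    split=> [y z s|y s s'|a y s|a y s].
    - by rewrite scalerDr.
    - by rewrite coordD scalerDl.
    - by rewrite !scalerA mulrC.
    - by rewrite coordZ scalerA.
  by apply: eq_bigr => i _; apply: linearZ.
move=> P b [bDl bDr bZl bZr].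
have b0l y : b 0 y = 0 by apply: (addrI (b 0 y)); rewrite -bDl !addr0.
have b0r y : b y 0 = 0 by apply: (addrI (b y 0)); rewrite -bDr !addr0.
have /choice[s sE] := fun i => coordE (r i).
pose s' := undup (flatten [seq s i | i <- enum 'I_k]).
have rE i : r i = \sum_(c <- s') pi (coord c (r i)) * e c.
  apply: sE => [|c ci]; first exact: undup_uniq.
  rewrite mem_undup; apply/flattenP; exists (s i) => //.
  by rewrite map_f ?mem_enum.
transitivity (\sum_(i < k) \sum_(c <- s') b (coord c (r i) *: x i) (e c)).
  apply: eq_bigr => i _; rewrite [in LHS](rE i) (big_morph _ (bDr _) (b0r _)).
  by apply: eq_bigr => c _; rewrite bZr bZl.
rewrite exchange_big /= big1 // => c _.
by rewrite -(big_morph _ (fun y z => bDl y z (e c)) (b0l _)) coord_eq0.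
Qed.

(** * The affine line *)

(** If x is not in m, then m and x together generate 1 = a + b x, and
    y = a y + b x y lies in m. *)
Lemma maximal_ideal_factor (A : comPzRingType) (m : A -> Prop) (x y : A) :
  maximal_ideal m -> m (x * y) -> m x \/ m y.
Proof.
move=> [m_ideal m1 m_max] mxy; have [m0 mD mM] := m_ideal.
have [mx|nmx] := pselect (m x); [by left|right].
pose I z := exists a b, m a /\ z = a + b * x.
have [I1|I1] := pselect (I 1); last first.
  case: nmx; apply: (m_max I) => //.
  - split=> [|z z' [a [b [ma ->]]] [a' [b' [ma' ->]]]|c z [a [b [ma ->]]]].
    + by exists 0, 0; rewrite mul0r addr0.
    + by exists (a + a'), (b + b'); split; [exact: mD|rewrite mulrDl addrACA].
    + by exists (c * a), (c * b); split; [exact: mM|rewrite mulrDr mulrA].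
  - by move=> z mz; exists z, 0; rewrite mul0r addr0.
  - by exists 0, 1; rewrite mul1r add0r.
have [a [b [ma E]]] := I1.
rewrite -[y]mul1r E mulrDl -mulrA; apply: mD; last exact: mM.
by rewrite mulrC; apply: mM.
Qed.

Definition vanishing_at (K : comNzRingType) (tau : K) (g : {poly K}) : Prop :=
  g.[tau] = 0.

Section AffineLine.
Variable K : fieldType.

Lemma poly_finite_type : @finite_type K {poly K}.
Proof.
pose ev : {mpoly K[1]} -> {poly K} := @alg_eval K {poly K} 1 (fun=> 'X).
suff ev_surj f : exists g, ev g = f by exists 1, (@alg_eval K {poly K} 1 (fun=> 'X)).
elim/poly_ind: f => [|f c [g gE]]; first by exists 0; rewrite /ev rmorph0.
exists (g * 'X_ord0 + c%:MP).
by rewrite /ev alg_evalD alg_evalM [X in X * _]gE alg_evalXi /alg_eval mmapC /= alg_polyC.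
Qed.

Lemma poly_rational_curve : @rational_curve K {poly K}.
Proof.
split; first exact: poly_finite_type.
exists (@tofrac {poly K} : {rmorphism _ -> _}); split.
- by move=> x y /eqP; rewrite tofrac_eq => /eqP.
- by move=> c; rewrite alg_polyC.
move=> z; exists \n_(repr z), \d_(repr z).
rewrite /= tofrac_eq0 denom_ratioP; split=> //.
rewrite -[LHS]reprK; unlock tofrac.
rewrite -[X in _ * X]FracField.pi_inv -[RHS]FracField.pi_mul.
rewrite /FracField.mulf /FracField.invf /= !numden_Ratio ?oner_neq0 ?denom_ratioP //.
by rewrite mulr1 mul1r Ratio_numden.
Qed.

(** An ideal with a polynomial g not vanishing at tau also contains the
    constant g(tau), since g - g(tau) vanishes there. *)
Lemma vanishing_at_maximal tau : maximal_ideal (@vanishing_at K tau).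
Proof.
have V_ideal : is_ideal (@vanishing_at K tau).
  split=> [|g h|a g]; rewrite /vanishing_at ?horner0 // ?hornerD ?hornerM.
    by move=> -> ->; rewrite addr0.
  by move=> ->; rewrite mulr0.
split=> // [|I [I0 ID IM] VI I1 g Ig]; first by move/eqP; rewrite hornerC oner_eq0.
apply/eqP; apply: contra_notT I1 => g_neq0.
have -> : 1 = (g.[tau])^-1%:P * (g + (-1) * (g - g.[tau]%:P)).
  by rewrite mulN1r subKr -polyCM mulVf.
apply/IM/ID => //; apply/IM/VI.
by rewrite /vanishing_at hornerD hornerN hornerC subrr.
Qed.

End AffineLine.

(** The Nullstellensatz in dimension one: a nonzero polynomial of m is a product
    of linear factors, one of which lies in m since m is prime. *)
Lemma maximal_ideal_vanishing (K : closedFieldType) (m : {poly K} -> Prop) :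
  maximal_ideal m -> exists tau, m = vanishing_at tau.
Proof.
move=> m_maximal; have [m_ideal m1 m_max] := m_maximal.
have [m0 mD mM] := m_ideal.
suff [tau m_tau] : exists tau, m ('X - tau%:P).
  have m_vanish g : vanishing_at tau g -> m g.
    by move=> /eqP/factor_theorem[h ->]; apply: mM.
  exists tau; apply/predeqP => g; split=> [mg|/m_vanish //].
  have [V_ideal V1 V_max] := vanishing_at_maximal tau.
  exact: V_max mg.
(* Otherwise m is the zero ideal, properly contained in the ideal (X). *)
have [g mg g_neq0] : exists2 g, m g & g != 0.
  apply: contrapT => m_eq0.
  have [V_ideal V1 _] := vanishing_at_maximal (0 : K).
  case: (m_eq0); exists 'X; last by rewrite polyX_eq0.
  apply: (m_max _ V_ideal) => //; last by rewrite /vanishing_at hornerX.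
  move=> h mh; have [->|h_neq0] := eqVneq h 0; first by rewrite /vanishing_at horner0.
  by case: m_eq0; exists h.
have [k] := ubnP (size g); elim: k => // k IHk in g mg g_neq0 * => size_g.
have [size1|size_neq1] := eqVneq (size g) 1%N.
  case: m1; have /size_poly1P[c c_neq0 E] : size g == 1%N by apply/eqP.
  have -> : 1 = c^-1%:P * g by rewrite E -polyCM mulVf.
  exact: mM.
have [tau /factor_theorem[h E]] := closed_rootP _ size_neq1.
move: mg; rewrite E => /(maximal_ideal_factor m_maximal)[mh|]; last by exists tau.
have h_neq0 : h != 0 by apply: contraNneq g_neq0 => h0; rewrite E h0 mul0r.
apply: (IHk h mh h_neq0).
by move: size_g; rewrite E size_Mmonic ?monicXsubC // size_XsubC addn2.
Qed.

(** * The family over the affine line *)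

Section Stripping.
Variable n : nat.
Implicit Types a b m : 'X_{1..n.+1}.

Definition ones : 'X_{1..n.+1} := [multinom 1 | _ < n.+1]%N.

Definition mnm_min a : nat := a [arg min_(i < ord0) a i].

Lemma mnm_min_le a i : (mnm_min a <= a i)%N.
Proof. by rewrite /mnm_min; case: arg_minnP => // j _; apply. Qed.

Lemma mnm_minP a : exists i, a i = mnm_min a.
Proof. by exists [arg min_(i < ord0) a i]. Qed.

Lemma mnm_minE a k : (exists i, a i = k) -> (forall i, k <= a i)%N -> mnm_min a = k.
Proof.
move=> [i aik] le_ka; apply/eqP; rewrite eqn_leq -{1}aik mnm_min_le /=.
by have [j <-] := mnm_minP a.
Qed.

Lemma mnm_min_eq0P a : reflect (exists i, a i = 0%N) (mnm_min a == 0%N).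
Proof.
apply: (iffP eqP) => [a0|[i ai]].
  by have [i ai] := mnm_minP a; exists i; rewrite ai a0.
by apply/eqP; rewrite -leqn0 -ai mnm_min_le.
Qed.

Lemma mnm_min0 : mnm_min 0%MM = 0%N.
Proof. by apply: mnm_minE => [|//]; exists ord0; rewrite mnm0E. Qed.

(** The representative with a vanishing coordinate modulo powers of t. *)
Definition strip a : 'X_{1..n.+1} := (a - ones *+ mnm_min a)%MM.

Lemma ones_mulE k i : (ones *+ k)%MM i = k.
Proof. by rewrite mulmnE mnmE mul1n. Qed.

Lemma stripK a : (strip a + ones *+ mnm_min a)%MM = a.
Proof. by apply/submK/mnm_lepP => i; rewrite ones_mulE mnm_min_le. Qed.

Lemma mnm_min_ones a : mnm_min (ones + a)%MM = (mnm_min a).+1.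
Proof.
apply: mnm_minE => [|i]; last by rewrite mnmDE mnmE add1n ltnS mnm_min_le.
by have [i ai] := mnm_minP a; exists i; rewrite mnmDE mnmE add1n ai.
Qed.

Lemma strip_ones a : strip (ones + a)%MM = strip a.
Proof.
apply/mnmP => i; rewrite /strip !mnmBE mnm_min_ones !ones_mulE mnmDE mnmE.
by rewrite add1n subSS.
Qed.

Lemma ones_le a : (ones <= a)%MM = (0 < mnm_min a)%N.
Proof.
apply/mnm_lepP/idP => [le_a|lt0a i]; last by rewrite mnmE (leq_trans lt0a) ?mnm_min_le.
by have [i <-] := mnm_minP a; have := le_a i; rewrite mnmE.
Qed.

End Stripping.

Section CongruenceDivision.
Variables (K : comNzRingType) (n : nat) (q : 'I_n.+1 -> nat).
Hypothesis q_gt0 : forall i, (0 < q i)%N.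
Local Notation B := (cong_alg K q).
Implicit Types (a b m : 'X_{1..n.+1}) (x y : B).

Let Q := \prod_i q i.

Lemma modulus_dvd_prod i : (q i %| Q)%N.
Proof. by rewrite /Q (bigD1 i) //= dvdn_mulr. Qed.

(** The exponents of B are all the nonnegative vectors of a group.  Here l is
    subtracted in the guise of adding l (Q - 1), with Q a common multiple of the
    moduli. *)
Lemma cong_mnmB a m : cong_mnm q a -> cong_mnm q m -> (m <= a)%MM ->
  cong_mnm q (a - m)%MM.
Proof.
move=> /cong_mnmP[k /shiftableP ak] /cong_mnmP[l /shiftableP ml] /mnm_lepP le_ma.
apply/cong_mnmP; exists (k + l * Q.-1)%N; apply/shiftableP => i.
have Q_gt0 : (0 < Q)%N by rewrite prodn_gt0.
rewrite -(dvdn_addl _ (ml i)).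
have -> : ((a - m)%MM i + (k + l * Q.-1) + (m i + l) = (a i + k) + l * Q)%N.
  by rewrite mnmBE -{2}(prednK Q_gt0) mulnS; have := le_ma i; lia.
by rewrite dvdn_add ?ak // dvdn_mull ?modulus_dvd_prod.
Qed.

Lemma cong_mnm_ones : cong_mnm q (ones n).
Proof.
apply/cong_mnmP; exists Q.-1; apply/shiftableP => i.
by rewrite mnmE add1n prednK ?modulus_dvd_prod // prodn_gt0.
Qed.

Lemma cong_mono_dvd m x : cong_mnm q m ->
  (forall a, a \in msupp (val x) -> (m <= a)%MM) -> exists y, x = cong_mono K q m * y.
Proof.
move=> Mm le_m.
exists (\sum_(a <- msupp (val x)) (val x)@_a *: cong_mono K q (a - m)%MM).
rewrite [LHS]cong_alg_monoE mulr_sumr big_seq [RHS]big_seq; apply: eq_bigr => a ax.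
have Ma : cong_mnm q a by move: a ax; apply/cong_polyP/valP.
by rewrite -scalerAr -cong_monoD ?cong_mnmB ?le_m // addmC submK ?le_m.
Qed.

(** The parameter t of the base, the product of all the variables z_i. *)
Definition base_param : B := cong_mono K q (ones n).

Lemma base_paramX k : base_param ^+ k = cong_mono K q (ones n *+ k)%MM.
Proof. exact/cong_monoX/cong_mnm_ones. Qed.

Definition base_map : {poly K} -> B := horner_alg base_param.

Lemma base_mapZ : scalable base_map.
Proof. by move=> c f; rewrite /base_map linearZ /= mulr_algl. Qed.

HB.instance Definition _ := GRing.RMorphism.on base_map.
HB.instance Definition _ := GRing.isScalable.Build K _ _ _ base_map base_mapZ.

Lemma base_mapX : base_map 'X = base_param.
Proof. exact: horner_algX. Qed.

Lemma base_mapXn k : base_map 'X^k = cong_mono K q (ones n *+ k)%MM.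
Proof. by rewrite /base_map rmorphXn /= horner_algX base_paramX. Qed.

(** The coefficient of z^m for the K[t]-basis of B formed by the monomials with
    a vanishing coordinate: z^a = t^(min a) z^(strip a). *)
Definition base_coord m (x : B) : {poly K} :=
  lin_ext (fun a => if strip a == m then 'X^(mnm_min a) else 0) (val x).

Lemma base_coordD m x y : base_coord m (x + y) = base_coord m x + base_coord m y.
Proof. by rewrite /base_coord cong_valD raddfD. Qed.

Lemma base_coordZ m c x : base_coord m (c *: x) = c *: base_coord m x.
Proof. by rewrite /base_coord cong_valZ linearZ. Qed.

Lemma base_coord_mono m a : cong_mnm q a ->
  base_coord m (cong_mono K q a) = if strip a == m then 'X^(mnm_min a) else 0.
Proof. by move=> Ma; rewrite /base_coord cong_val_mono // lin_extX. Qed.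

Lemma base_coordX m x : base_coord m (base_param * x) = 'X * base_coord m x.
Proof.
have bc0 : base_coord m 0 = 0.
  by apply: (addrI (base_coord m 0)); rewrite -base_coordD !addr0.
elim/cong_alg_ind: x => [|c a x Ma IHx]; first by rewrite mulr0 bc0 mulr0.
rewrite mulrDr !base_coordD IHx mulrDr -scalerAr !base_coordZ -scalerAr.
rewrite -cong_monoD ?cong_mnm_ones // !base_coord_mono ?cong_mnmD ?cong_mnm_ones //.
by rewrite strip_ones mnm_min_ones; case: eqP => _; rewrite ?exprS ?mulr0.
Qed.

Lemma base_coord_base m f x : base_coord m (base_map f * x) = f * base_coord m x.
Proof.
elim/poly_ind: f x => [|f c IHf] x.
  by rewrite /base_map rmorph0 !mul0r -[0 in LHS](scale0r (0 : B)) base_coordZ scale0r.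
rewrite /base_map rmorphD rmorphM /= -/(base_map f) horner_algX horner_algC.
by rewrite !mulrDl base_coordD -!mulrA IHf base_coordX mulr_algl base_coordZ mul_polyC.
Qed.

Lemma cong_mnm_strip a : cong_mnm q a -> cong_mnm q (strip a).
Proof.
move=> Ma; apply: cong_mnmB => //; first exact/cong_mnmMn/cong_mnm_ones.
by rewrite -{2}(stripK a) lem_addl.
Qed.

Lemma base_coord_sum s x : uniq s -> {subset map (@strip n) (msupp (val x)) <= s} ->
  x = \sum_(m <- s) base_map (base_coord m x) * cong_mono K q m.
Proof.
move=> s_uniq sub_s.
have coordE m : base_coord m x =
    \sum_(a <- msupp (val x)) (val x)@_a *: base_coord m (cong_mono K q a).
  rewrite /base_coord {1}/lin_ext big_seq [RHS]big_seq; apply: eq_bigr => a ax.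
  by rewrite cong_val_mono ?lin_extX //; move: a ax; apply/cong_polyP/valP.
under eq_bigr do rewrite coordE raddf_sum mulr_suml.
rewrite exchange_big [LHS]cong_alg_monoE big_seq [RHS]big_seq; apply: eq_bigr => a ax.
have Ma : cong_mnm q a by move: a ax; apply/cong_polyP/valP.
rewrite (bigD1_seq (strip a)) //=; last by apply/sub_s/map_f.
rewrite big1 => [|m /negPf ma]; last first.
  by rewrite base_coord_mono // eq_sym ma scaler0 raddf0 mul0r.
rewrite base_coord_mono // eqxx addr0 base_mapZ -scalerAl; congr (_ *: _).
rewrite base_mapXn -cong_monoD.
- by rewrite addmC stripK.
- exact/cong_mnmMn/cong_mnm_ones.
- exact: cong_mnm_strip.
Qed.

Lemma base_map_flat : flat (base_map : {lrmorphism _ -> _}).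
Proof.
apply: (coordinates_flat (e := cong_mono K q) base_coordD base_coord_base) => x.
exists (map (@strip n) (msupp (val x))) => s; exact: base_coord_sum.
Qed.

(** The monomials with exponents at most Q generate B: if a_j > Q, then
    z_j^(q_j), which is one of them, divides z^a in B. *)
Lemma cong_alg_finite_type : finite_type (B : comAlgType K).
Proof.
pose N := #|{: {ffun 'I_n.+1 -> 'I_Q.+1}}|.
pose box (i : 'I_N) : 'X_{1..n.+1} := [multinom val (enum_val i j) | j < n.+1].
pose ev : {mpoly K[N]} -> B := @alg_eval K B N (fun i => cong_mono K q (box i)).
suff ev_surj x : exists g, ev g = x.
  by exists N, (@alg_eval K B N (fun i => cong_mono K q (box i))).
have ev_mono a : cong_mnm q a -> exists g, ev g = cong_mono K q a.
  have [k] := ubnP (mdeg a); elim: k a => // k IHk a deg_a Ma.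
  have [/forallP le_aQ|] := boolP [forall i, a i <= Q]%N.
    pose i : 'I_N := enum_rank [ffun j => inord (a j) : 'I_Q.+1].
    exists 'X_i; rewrite [LHS]alg_evalXi; congr cong_mono.
    by apply/mnmP => j; rewrite mnmE enum_rankK ffunE /= inordK // ltnS.
  rewrite negb_forall => /existsP[j]; rewrite -ltnNge => lt_Qa.
  pose m := (U_(j) *+ q j)%MM.
  have Mm : cong_mnm q m.
    apply/cong_mnmP; exists 0; apply/shiftableP => i.
    by rewrite addn0 mulmnE mnm1E; case: eqP => [->|]; rewrite ?mul1n ?dvdnn.
  have le_ma : (m <= a)%MM.
    apply/mnm_lepP => i; rewrite mulmnE mnm1E; case: eqP => [<-|] //.
    rewrite mul1n (leq_trans _ (ltnW lt_Qa)) // dvdn_leq ?modulus_dvd_prod //.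
    by rewrite prodn_gt0.
  have mdeg_m : mdeg m = q j by rewrite mdegMn mdeg1 mul1n.
  have [||g gE] := IHk (a - m)%MM; last 1 first.
  - exists ('X_(enum_rank [ffun i => inord (m i) : 'I_Q.+1]) * g).
    rewrite /ev alg_evalM [X in _ * X]gE alg_evalXi.
    rewrite -[in RHS](submK le_ma) addmC cong_monoD ?cong_mnmB //.
    congr (cong_mono _ _ _ * _); apply/mnmP => i.
    rewrite mnmE enum_rankK ffunE /= inordK // ltnS mulmnE mnm1E.
    by case: eqP => _; rewrite ?mul1n // dvdn_leq ?modulus_dvd_prod ?prodn_gt0.
  - move: deg_a; rewrite -{1}(submK le_ma) mdegD mdeg_m => deg_a.
    by rewrite -ltnS (leq_trans _ deg_a) // ltnS -addn1 leq_add2l.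
  - exact: cong_mnmB.
elim/cong_alg_ind: x => [|c a x Ma [g gE]].
  by exists 0; rewrite /ev rmorph0.
have [h hE] := ev_mono a Ma; exists (c%:MP * h + g).
rewrite /ev alg_evalD alg_evalM [X in _ + X]gE [X in _ * X]hE.
by rewrite /alg_eval mmapC /= mulr_algl.
Qed.

End CongruenceDivision.

Lemma principal_idealP (A : comPzRingType) (S : A -> Prop) (s : A) :
  generated_ideal S s -> (forall x, S x -> exists y, x = s * y) ->
  forall x, generated_ideal S x <-> exists y, x = s * y.
Proof.
move=> Ss sS x; split=> [|[y ->]]; last by rewrite mulrC; apply: generated_idealMl.
move: x; apply: generated_ideal_sub; first by exists 0; rewrite mulr0.
  by move=> x y [x' ->] [y' ->]; exists (x' + y'); rewrite mulrDr.
by move=> a x /sS[y ->]; exists (a * y); rewrite mulrCA.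
Qed.

Lemma base_map_idealP (K : comNzRingType) (n : nat) (q : 'I_n.+1 -> nat) (tau : K)
    (x : cong_alg K q) :
  generated_ideal (pulled_back (@base_map K n q) (vanishing_at tau)) x <->
  exists y, x = (base_param K q - tau%:A) * y.
Proof.
have E : base_map q ('X - tau%:P) = base_param K q - tau%:A.
  by rewrite /base_map raddfB /= horner_algX horner_algC.
apply: principal_idealP => [|y].
  apply: generated_ideal_gen; exists ('X - tau%:P) => //.
  by rewrite /vanishing_at hornerXsubC subrr.
case=> g /eqP/factor_theorem[h ->] ->; exists (base_map q h).
by rewrite -E mulrC -rmorphM.
Qed.

(** * The fibres away from zero *)

Section Weights.
Variables (n : nat) (p : 'I_n.+1 -> nat).

Definition weight_prod : nat := \prod_i p i.
(** The modulus q_i = d / p_i of the i-th variable. *)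
Definition coweight (i : 'I_n.+1) : nat := \prod_(j | j != i) p j.

Lemma coweightM i : (coweight i * p i = weight_prod)%N.
Proof. by rewrite /weight_prod (bigD1 i) //= mulnC. Qed.

Lemma coweight_gt0 : (forall i, 0 < p i)%N -> forall i, (0 < coweight i)%N.
Proof. by move=> p_gt0 i; rewrite prodn_gt0. Qed.

Hypothesis p_gcd : \big[gcdn/0%N]_j p j = 1%N.

(** The lcm of the q_i is d, not a proper divisor, because d divides p_i D for
    every i and hence gcd(p) D = D. *)
Lemma coweight_dvd D : (forall i, 0 < p i)%N -> (forall i, coweight i %| D)%N ->
  (weight_prod %| D)%N.
Proof.
move=> p_gt0 qD; rewrite -[D]mul1n -p_gcd.
rewrite (big_morph (muln^~ D) (fun x y => muln_gcdl x y D) (mul0n D)).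
by apply/dvdn_biggcdP => i _; rewrite -(coweightM i) mulnC dvdn_mul.
Qed.

End Weights.

Section Shift.
Variables (n : nat) (q : 'I_n -> nat).
Definition shift (a : 'X_{1..n}) : nat :=
  if pselect (exists k, shiftable q a k) is left H then sval (cid H) else 0.

Lemma shiftP a : cong_mnm q a -> shiftable q a (shift a).
Proof.
by move=> /cong_mnmP ak; rewrite /shift; case: pselect => // H; case: cid.
Qed.
End Shift.

Section TorusFibre.
Variables (K : fieldType) (n : nat) (p : 'I_n.+1 -> nat).
Hypotheses (p_gt0 : forall i, (0 < p i)%N) (p_gcd : \big[gcdn/0%N]_j p j = 1%N).
Local Notation q := (coweight p).
Local Notation d := (weight_prod p).
Local Notation B := (cong_alg K q).
Local Notation t := (base_param K q).
Let q_gt0 := coweight_gt0 p_gt0.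
Implicit Types (a b u : 'X_{1..n.+1}) (k l : nat).

Definition coord_mnm i : 'X_{1..n.+1} := (U_(i) *+ q i)%MM.

Lemma coord_mnmE i j : coord_mnm i j = ((i == j) * q j)%N.
Proof. by rewrite mulmnE mnm1E; case: eqP => // ->. Qed.

Lemma cong_mnm_coord i : cong_mnm q (coord_mnm i).
Proof.
by apply/cong_mnmP; exists 0; apply/shiftableP => j; rewrite addn0 coord_mnmE dvdn_mull.
Qed.

(** The coordinate x_i = z_i^(q_i) of the torus. *)
Definition torus_coord i : B := cong_mono K q (coord_mnm i).

Definition scale_mnm u : 'X_{1..n.+1} := [multinom (u i * q i)%N | i < n.+1].

Lemma cong_mnm_scale u : cong_mnm q (scale_mnm u).
Proof.
by apply/cong_mnmP; exists 0; apply/shiftableP => j; rewrite addn0 mnmE dvdn_mull.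
Qed.

Lemma coord_prod u : \prod_i torus_coord i ^+ u i = cong_mono K q (scale_mnm u).
Proof.
have -> : scale_mnm u = (\sum_i coord_mnm i *+ u i)%MM.
  apply/mnmP => j; rewrite mnmE mnm_sumE (bigD1 j) //= big1 => [|i /negPf ij].
    by rewrite mulmnE coord_mnmE eqxx mul1n addn0 mulnC.
  by rewrite mulmnE coord_mnmE ij.
rewrite -cong_mono_prod => [|i]; last exact/cong_mnmMn/cong_mnm_coord.
by apply: eq_bigr => i _; rewrite cong_monoX ?cong_mnm_coord.
Qed.

Lemma coord_prod_weights : \prod_i torus_coord i ^+ p i = t ^+ d.
Proof.
rewrite (eq_bigr (fun i => torus_coord i ^+ [multinom p i | i < n.+1] i)); last first.
  by move=> i _; rewrite mnmE.
rewrite coord_prod base_paramX //; congr cong_mono; apply/mnmP => i.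
by rewrite ones_mulE !mnmE mulnC coweightM.
Qed.

(** The exponent u with z^a t^k = x^u, for k as in [shiftable]. *)
Definition unscale a k : 'X_{1..n.+1} := [multinom ((a i + k) %/ q i)%N | i < n.+1].

Lemma unscaleK a k : shiftable q a k -> scale_mnm (unscale a k) = (a + ones n *+ k)%MM.
Proof.
move=> /shiftableP ak; apply/mnmP => i.
by rewrite mnmDE ones_mulE !mnmE divnK.
Qed.

Variables (tau : K) (c : 'I_n.+1 -> K).
Hypotheses (tau_neq0 : tau != 0) (c_weights : \prod_i c i ^+ p i = tau ^+ d).

Lemma scaling_neq0 i : c i != 0.
Proof.
apply: contraNneq (expf_neq0 d tau_neq0) => ci0.
by rewrite -c_weights (bigD1 i) //= ci0 expr0n gtn_eqF ?mul0r // p_gt0.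
Qed.

(** With constants c_i such that c^p = tau^d, the map X_i |-> x_i / c_i sends
    X^p - 1 into the ideal of the fibre t = tau; it induces the isomorphism from
    the torus onto this fibre. *)
Definition to_fibre : {mpoly K[n.+1]} -> B :=
  @alg_eval K B _ (fun i => (c i)^-1 *: torus_coord i).
HB.instance Definition _ := GRing.LRMorphism.on to_fibre.

(** The inverse of [to_fibre] on z^a = x^u t^(-k), where t is replaced by tau
    and x_i by c_i X_i.  It is a linear map only, which is multiplicative up to
    the ideal of the torus. *)
Definition of_fibre_mono a k : {mpoly K[n.+1]} :=
  (tau ^- k * \prod_i c i ^+ unscale a k i) *: 'X_[unscale a k].

Definition of_fibre (x : B) : {mpoly K[n.+1]} :=
  lin_ext (fun a => of_fibre_mono a (shift q a)) (val x).

Lemma to_fibreD x y : to_fibre (x + y) = to_fibre x + to_fibre y.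
Proof. exact: raddfD. Qed.

Lemma to_fibreZ e x : to_fibre (e *: x) = e *: to_fibre x.
Proof. exact: linearZ. Qed.

Lemma to_fibreM x y : to_fibre (x * y) = to_fibre x * to_fibre y.
Proof. exact: rmorphM. Qed.

Lemma to_fibre0 : to_fibre 0 = 0.
Proof. exact: raddf0. Qed.

Lemma to_fibreX u :
  to_fibre 'X_[u] = (\prod_i c i ^+ u i)^-1 *: cong_mono K q (scale_mnm u).
Proof.
rewrite /to_fibre alg_evalX -coord_prod.
under eq_bigr do rewrite exprZn.
rewrite scaler_prod; congr (_ *: _).
by rewrite -prodfV; apply: eq_bigr => i _; rewrite exprVn.
Qed.

Lemma to_fibre_mono a k : cong_mnm q a -> shiftable q a k ->
  to_fibre (of_fibre_mono a k) = tau ^- k *: (t ^+ k * cong_mono K q a).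
Proof.
move=> Ma ak; rewrite /of_fibre_mono to_fibreZ to_fibreX scalerA mulfK; last first.
  by apply/prodf_neq0 => i _; rewrite expf_neq0 ?scaling_neq0.
rewrite unscaleK // base_paramX // -cong_monoD //; last exact/cong_mnmMn/cong_mnm_ones.
by rewrite addmC.
Qed.

Local Notation in_torus := (generated_ideal (@torus_eq K n p)).
Local Notation in_fibre :=
  (generated_ideal (pulled_back (@base_map K n q) (vanishing_at tau))).

Lemma torus_expP e : in_torus ((\prod_i 'X_i ^+ p i) ^+ e - 1).
Proof.
rewrite -[X in _ - X](expr1n _ e) subrXX mulrC; apply/generated_idealMl/generated_ideal_gen.
by [].
Qed.

(** Two admissible shifts of a differ by a multiple e d of d; this multiplies
    X^u by (X^p)^e, which is 1 on the torus, and the scalar by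
    tau^(- e d) (c^p)^e = 1. *)
Lemma of_fibre_mono_shift a k l : shiftable q a k -> shiftable q a l ->
  in_torus (of_fibre_mono a k - of_fibre_mono a l).
Proof.
wlog le_kl : k l / (k <= l)%N => [hw ak al|].
  case/orP: (leq_total k l) => ?; first exact: hw.
  by rewrite -opprB -mulN1r; apply/generated_idealMl/hw.
move=> /shiftableP ak /shiftableP al.
have /dvdnP[e le] : (d %| l - k)%N.
  apply: coweight_dvd => // i; rewrite -(dvdn_addl _ (ak i)).
  by have -> : (l - k + (a i + k) = a i + l)%N by lia.
have {le}-> : (l = k + e * d)%N by rewrite -le subnKC.
have uE i : unscale a (k + e * d) i = (unscale a k i + p i * e)%N.
  rewrite !mnmE addnA divnDl // -(coweightM p i) mulnA mulnAC mulnK //.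
  by rewrite mulnC.
have -> : of_fibre_mono a (k + e * d) = of_fibre_mono a k * (\prod_i 'X_i ^+ p i) ^+ e.
  rewrite /of_fibre_mono -scalerAl; congr (_ *: _).
    rewrite exprD invfM -mulrA; congr (_ * _).
    under eq_bigr do rewrite uE exprD exprM.
    rewrite big_split prodrXl c_weights -exprM mulnC [X in _ * X]mulrC mulKf //.
    by rewrite expf_neq0.
  rewrite !mpolyXE_id -prodrXl -big_split; apply: eq_bigr => i _ /=.
  by rewrite uE exprD exprM.
set s := (\prod_i 'X_i ^+ p i) ^+ e.
have -> : of_fibre_mono a k - of_fibre_mono a k * s = - of_fibre_mono a k * (s - 1).
  by rewrite mulrBr mulr1 opprK mulNr addrC.
by apply: generated_idealMl; apply: torus_expP.
Qed.

Lemma in_torusP x : in_torus x <-> exists y, x = (\prod_i 'X_i ^+ p i - 1) * y.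
Proof.
apply: principal_idealP => [|_ ->]; first exact: generated_ideal_gen.
by exists 1; rewrite mulr1.
Qed.

Lemma of_fibreD x y : of_fibre (x + y) = of_fibre x + of_fibre y.
Proof. by rewrite /of_fibre cong_valD raddfD. Qed.

Lemma of_fibreZ e (x : B) : of_fibre (e *: x) = e *: of_fibre x.
Proof. by rewrite /of_fibre cong_valZ linearZ. Qed.

Lemma of_fibreE a : cong_mnm q a ->
  of_fibre (cong_mono K q a) = of_fibre_mono a (shift q a).
Proof. by move=> Ma; rewrite /of_fibre cong_val_mono // lin_extX. Qed.

Lemma of_fibre0 : of_fibre 0 = 0.
Proof. by rewrite -(scale0r 0) of_fibreZ scale0r. Qed.

(** On monomials: a shift k of a + (1, ..., 1) is the shift k + 1 of a, so
    multiplication by t becomes multiplication by tau. *)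
Lemma of_fibre_in_torus x : in_fibre x -> in_torus (of_fibre x).
Proof.
move=> /base_map_idealP[y ->]; elim/cong_alg_ind: y => [|e a y Ma IHy].
  by rewrite mulr0 of_fibre0; apply: generated_ideal0.
rewrite mulrDr of_fibreD; apply: generated_idealD => //.
rewrite -scalerAr of_fibreZ -mul_mpolyC; apply: generated_idealMl.
rewrite mulrBl mulr_algl -cong_monoD ?cong_mnm_ones //.
rewrite -scaleNr of_fibreD of_fibreZ !of_fibreE ?cong_mnmD ?cong_mnm_ones //.
set k := shift q (ones n + a)%MM.
have -> : of_fibre_mono (ones n + a)%MM k = tau *: of_fibre_mono a k.+1.
  have uE : unscale (ones n + a)%MM k = unscale a k.+1.
    by apply/mnmP => i; rewrite !mnmE add1n addSnnS.
  rewrite /of_fibre_mono uE scalerA exprS invfM.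
  by rewrite !mulrA mulfV // mul1r.
rewrite scaleNr -scalerBr -mul_mpolyC; apply/generated_idealMl/of_fibre_mono_shift.
  have /shiftableP ak : shiftable q (ones n + a)%MM k.
    by apply/shiftP/cong_mnmD => //; apply: cong_mnm_ones.
  by apply/shiftableP => i; have := ak i; rewrite mnmDE mnmE add1n addSnnS.
exact: shiftP.
Qed.

Lemma to_fibreK x : in_torus (of_fibre (to_fibre x) - x).
Proof.
elim/mpolyind: x => [|e u x _ _ IHx].
  by rewrite to_fibre0 of_fibre0 subrr; apply: generated_ideal0.
rewrite to_fibreD of_fibreD opprD addrACA.
apply: generated_idealD => //.
rewrite to_fibreZ of_fibreZ -scalerBr -mul_mpolyC; apply: generated_idealMl.
rewrite to_fibreX of_fibreZ of_fibreE ?cong_mnm_scale //.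
have u0 : unscale (scale_mnm u) 0 = u.
  by apply/mnmP => i; rewrite !mnmE addn0 mulnK.
have -> : 'X_[u] = (\prod_i c i ^+ u i)^-1 *: of_fibre_mono (scale_mnm u) 0.
  rewrite /of_fibre_mono u0 expr0 invr1 mul1r scalerA mulVf ?scale1r //.
  by apply/prodf_neq0 => i _; rewrite expf_neq0 ?scaling_neq0.
rewrite -scalerBr -mul_mpolyC; apply: generated_idealMl; apply: of_fibre_mono_shift.
  by apply/shiftP/cong_mnm_scale.
by apply/shiftableP => i; rewrite addn0 mnmE dvdn_mull.
Qed.

Lemma of_fibreK x : in_fibre (to_fibre (of_fibre x) - x).
Proof.
elim/cong_alg_ind: x => [|e a x Ma IHx].
  by rewrite of_fibre0 to_fibre0 subrr; apply: generated_ideal0.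
rewrite of_fibreD to_fibreD opprD addrACA.
apply: generated_idealD => //.
rewrite of_fibreZ to_fibreZ -scalerBr -mulr_algl; apply: generated_idealMl.
rewrite of_fibreE // to_fibre_mono ?shiftP //; set k := shift q a.
have -> : tau ^- k *: (t ^+ k * cong_mono K q a) - cong_mono K q a =
    (tau ^- k *: cong_mono K q a) * (t ^+ k - (tau%:A) ^+ k).
  rewrite mulrBr -scalerAl mulrC -scalerAl; congr (_ - _).
  by rewrite exprZn expr1n mulr_algr scalerA mulVf ?scale1r // expf_neq0.
apply/generated_idealMl/base_map_idealP.
by rewrite subrXX; eexists.
Qed.

Lemma to_fibre_ideal x : in_fibre (to_fibre x) <-> in_torus x.
Proof.
split=> [x0|].
  rewrite -[x](subKr (of_fibre (to_fibre x))); apply: generated_idealB.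
    exact: of_fibre_in_torus.
  exact: to_fibreK.
move=> /in_torusP[y ->]; rewrite to_fibreM mulrC; apply: generated_idealMl.
pose pm : 'X_{1..n.+1} := [multinom p i | i < n.+1].
have -> : \prod_i 'X_i ^+ p i - 1 = 'X_[pm] + (-1) *: 'X_[0] :> {mpoly K[n.+1]}.
  rewrite mpolyX0 scaleN1r mpolyXE_id; congr (_ - _).
  by apply: eq_bigr => i _; rewrite mnmE.
rewrite to_fibreD to_fibreZ scaleN1r !to_fibreX.
have -> : cong_mono K q (scale_mnm pm) = t ^+ d.
  rewrite -coord_prod -coord_prod_weights.
  by apply: eq_bigr => i _; rewrite mnmE.
have -> : scale_mnm 0%MM = 0%MM by apply/mnmP => i; rewrite !mnmE.
have -> : \prod_i c i ^+ (0%MM : 'X_{1..n.+1}) i = 1.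
  by rewrite big1 // => i _; rewrite mnm0E.
under eq_bigr do rewrite mnmE.
rewrite cong_mono0 c_weights invr1 scale1r.
have -> : tau ^- d *: t ^+ d - 1 = tau ^- d *: (t ^+ d - tau%:A ^+ d).
  by rewrite scalerBr exprZn expr1n scalerA mulVf ?scale1r // expf_neq0.
rewrite -[_ *: (_ - _)]mulr_algl; apply/generated_idealMl/base_map_idealP.
by rewrite subrXX; eexists.
Qed.

(** [to_fibre] goes from the torus to the fibre and carries sum_i X_i^(w_i) to
    f / lam; the statement asks for its inverse. *)
Lemma fibre_torus (w : 'I_n.+1 -> nat) (lam : K) : lam != 0 ->
  (forall i, c i ^+ w i = lam) ->
  fibre_is_torus (@base_map K n q) p w (\sum_i torus_coord i ^+ w i)
    (vanishing_at tau) lam.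
Proof.
move=> lam_neq0 cw.
have [|phi [phi_iso phiE]] := @quot_map_iso K _ _ _ _ to_fibre to_fibre_ideal.
  move=> y; exists (of_fibre y); rewrite -opprB -mulN1r.
  exact/generated_idealMl/of_fibreK.
have [psi [psi_iso phiK]] := alg_isomorphism_inv phi_iso.
exists psi; split=> //.
have -> : \sum_i torus_coord i ^+ w i = to_fibre (lam *: \sum_i 'X_i ^+ w i).
  rewrite to_fibreZ.
  have -> : to_fibre (\sum_i 'X_i ^+ w i) = \sum_i to_fibre ('X_i ^+ w i).
    exact: raddf_sum.
  rewrite scaler_sumr; apply: eq_bigr => i _.
  have -> : to_fibre ('X_i ^+ w i) = to_fibre 'X_i ^+ w i by exact: rmorphXn.
  by rewrite /to_fibre alg_evalXi exprZn scalerA exprVn cw mulfV ?scale1r.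
by rewrite -phiE phiK; apply/esym/(class_ofZ (@torus_eq K n p)).
Qed.

End TorusFibre.

(** * The lattice of the stacky fan and the central fibre *)

Section LatticeMonomials.
Variables (n : nat) (p : 'I_n.+1 -> nat).
Hypotheses (p_gt0 : forall i, (0 < p i)%N) (p_gcd : \big[gcdn/0%N]_j p j = 1%N).
Local Notation q := (coweight p).
Local Notation d := (weight_prod p).
Let q_gt0 := coweight_gt0 p_gt0.
Implicit Types (a b : 'X_{1..n.+1}) (v : 'rV[int]_n.+1).

(** The class in N = Z^{n+1} / Z p of the v with a_i = q_i v_i + k. *)
Definition mnm_class a : Nlat p :=
  lattice_class p (\row_i (unscale p a (shift q a) i)%:Z).

(** Characterizes the class by the equations a_i = q_i v_i + k for any integer
    k.  If two solutions v and v' have the same a, then q_i (v_i - v'_i) is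
    independent of i; being divisible by all the q_i it is a multiple f d, and
    v - v' = f p. *)
Lemma mnm_classP a v : cong_mnm q a ->
  mnm_class a = lattice_class p v <->
  exists k : int, forall i, (a i)%:Z = (q i)%:Z * v 0 i + k.
Proof.
move=> Ma; have /shiftableP as_dvd := shiftP Ma; set s := shift q a in as_dvd.
have aE i : (a i)%:Z = (q i)%:Z * (unscale p a s i)%:Z - s%:Z.
  by rewrite -PoszM mnmE mulnC divnK // PoszD addrK.
rewrite /mnm_class -/s; split=> [/lattice_classP[k /matrixP kE]|[k kE]].
  exists (k * d%:Z - s%:Z) => i; rewrite aE.
  have := kE 0 i; rewrite !mxE natz => /(canRL (subrK _)) ->.
  by rewrite mulrDr -(coweightM p i) PoszM addrA; congr (_ - _); rewrite addrC mulrCA.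
have qE i : (q i)%:Z * ((unscale p a s i)%:Z - v 0 i) = k + s%:Z.
  by rewrite mulrBr; have := aE i; rewrite kE; lia.
have /dvdnP[e eE] : (d %| `|(k + s%:Z)%R|)%N.
  by apply: coweight_dvd => // i; rewrite -(qE i) abszM /= dvdn_mulr.
have [f fE] : exists f : int, k + s%:Z = f * d%:Z.
  exists (sgz (k + s%:Z) * e%:Z).
  by rewrite {1}[k + s%:Z]intEsg eE PoszM mulrA.
apply/lattice_classP; exists f; apply/matrixP => i0 i; rewrite ord1 !mxE natz.
have q_neq0 : (q i)%:Z != 0 by rewrite eqz_nat -lt0n.
by apply: (mulfI q_neq0); rewrite qE fE -(coweightM p i) PoszM mulrCA.
Qed.

Lemma mnm_classD a b : cong_mnm q a -> cong_mnm q b ->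
  mnm_class (a + b)%MM = mnm_class a + mnm_class b.
Proof.
move=> Ma Mb; rewrite /mnm_class -lattice_classD -/(mnm_class _).
have [k aE] := (mnm_classP _ Ma).1 (erefl (mnm_class a)).
have [l bE] := (mnm_classP _ Mb).1 (erefl (mnm_class b)).
apply/(mnm_classP _ (cong_mnmD Ma Mb)).
exists (k + l) => i; rewrite mnmDE PoszD aE bE.
by rewrite addrACA -mulrDr [in RHS]mxE.
Qed.

Lemma mnm_class_ones a : cong_mnm q a -> mnm_class (ones n + a)%MM = mnm_class a.
Proof.
move=> Ma; have [k aE] := (mnm_classP _ Ma).1 (erefl (mnm_class a)).
apply/(mnm_classP _ (cong_mnmD (cong_mnm_ones q_gt0) Ma)).
by exists (k + 1) => i; rewrite mnmDE mnmE add1n -addn1 PoszD aE addrA.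
Qed.

Lemma mnm_class0 : mnm_class 0%MM = 0.
Proof.
rewrite -lattice_class0; apply/(mnm_classP _ (cong_mnm0 _)).
by exists 0 => i; rewrite mnm0E mxE mulr0.
Qed.

Lemma mnm_class_scale (u : 'X_{1..n.+1}) :
  mnm_class (scale_mnm p u) = lattice_class p (\row_i (u i)%:Z).
Proof.
apply/(mnm_classP _ (cong_mnm_scale _ _)).
by exists 0 => i; rewrite addr0 !mxE mnmE -PoszM mulnC.
Qed.

(** The facet opposite to j consists of the v with v_j / p_j minimal, and
    v_i / p_i = q_i v_i / d differs from a_i / d by a constant. *)
Lemma in_facet_mnm_class a j : cong_mnm q a ->
  in_facet j (mnm_class a) <-> forall i, (a j <= a i)%N.
Proof.
move=> Ma; have [k aE] := (mnm_classP _ Ma).1 (erefl (mnm_class a)).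
have E i (v : 'rV[int]_n.+1) :
    v 0 j * (p i)%:Z <= v 0 i * (p j)%:Z =
    ((q j)%:Z * v 0 j <= (q i)%:Z * v 0 i).
  have pij : 0 < (p i)%:Z * (p j)%:Z by rewrite -PoszM ltz_nat muln_gt0 !p_gt0.
  have d_gt0 : 0 < d%:Z by rewrite ltz_nat prodn_gt0.
  rewrite -(ler_pM2r d_gt0) -[RHS](ler_pM2r pij).
  rewrite -{1}(coweightM p j) -(coweightM p i) !PoszM.
  by congr (_ <= _); [rewrite mulrACA [RHS]mulrACA|]; rewrite -!mulrA; lia.
rewrite in_facet_class.
by split=> H i; have := H i; rewrite E -(lerD2r k) -!aE lez_nat.
Qed.

(** Equal classes force a - b to be a multiple of (1, ..., 1). *)
Lemma mnm_class_inj a b : cong_mnm q a -> cong_mnm q b ->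
  mnm_min a = 0%N -> mnm_min b = 0%N -> mnm_class a = mnm_class b -> a = b.
Proof.
move=> Ma Mb a0 b0 ab; have [k aE] := (mnm_classP _ Ma).1 ab.
have [l bE] := (mnm_classP _ Mb).1 (erefl (mnm_class b)).
have [i ai] := mnm_minP a; have [j bj] := mnm_minP b.
have abE h : (a h)%:Z - (b h)%:Z = k - l by rewrite aE bE opprD addrACA subrr add0r.
apply/mnmP => h; apply/eqP; rewrite -eqz_nat -subr_eq0 abE; apply/eqP.
by have := abE i; have := abE j; rewrite ai a0 bj b0; lia.
Qed.

(** From a representative v subtract the least of the q_i v_i. *)
Lemma mnm_class_surj (c : Nlat p) :
  exists a, [/\ cong_mnm q a, mnm_min a = 0%N & mnm_class a = c].
Proof.
pose r i : int := (q i)%:Z * (repr c) 0 i.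
have [j _ rj] := @arg_minP _ int _ ord0 predT r isT.
pose a : 'X_{1..n.+1} := [multinom `|(r i - r j)%R|%N | i < n.+1].
have aE i : (a i)%:Z = r i - r j by rewrite mnmE gez0_abs // subr_ge0 rj.
have d_gt0 : (0 < d)%N by rewrite prodn_gt0.
have Ma : cong_mnm q a.
  (* r j made nonnegative without changing it modulo d *)
  apply/cong_mnmP; exists `|(r j + `|r j| * d%:Z)%R|%N; apply/shiftableP => i.
  have s_ge0 : 0 <= r j + `|r j| * d%:Z.
    have : `|r j| <= `|r j| * d%:Z by rewrite ler_peMr ?normr_ge0 // lez_nat.
    by have := ler_norm (- r j); rewrite normrN; lia.
  suff : (q i %| (a i)%:Z + `|(r j + `|r j| * d%:Z)%R|%N)%Z by [].
  rewrite gez0_abs // aE addrA subrK; apply: rpredD; first exact: dvdz_mulr.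
  by apply: dvdz_mull; rewrite -(coweightM p i) PoszM dvdz_mulr.
exists a; split=> //.
  by apply: mnm_minE => [|//]; exists j; rewrite mnmE subrr.
rewrite -[RHS](lattice_classK c); apply/(mnm_classP _ Ma).
by exists (- r j) => i; rewrite aE.
Qed.

End LatticeMonomials.

Section CentralFibre.
Variables (K : comNzRingType) (n : nat) (p : 'I_n.+1 -> nat).
Hypotheses (p_gt0 : forall i, (0 < p i)%N) (p_gcd : \big[gcdn/0%N]_j p j = 1%N).
Local Notation q := (coweight p).
Local Notation B := (cong_alg K q).
Local Notation t := (base_param K q).
Local Notation S := (fan_alg K p_gt0).
Let q_gt0 := coweight_gt0 p_gt0.
Implicit Types (a b : 'X_{1..n.+1}) (x y : B).

Definition fan_mono (c : Nlat p) : S := mono 1 c.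

Definition central_mono a : S :=
  if mnm_min a == 0%N then fan_mono (mnm_class p a) else 0.

(** The restriction of functions to the fibre t = 0. *)
Definition central (x : B) : S := lin_ext central_mono (val x).

Lemma centralD x y : central (x + y) = central x + central y.
Proof. by rewrite /central cong_valD raddfD. Qed.

Lemma centralZ e x : central (e *: x) = e *: central x.
Proof. by rewrite /central cong_valZ linearZ. Qed.

Lemma central0 : central 0 = 0.
Proof. by rewrite -(scale0r 0) centralZ scale0r. Qed.

Lemma centralE a : cong_mnm q a -> central (cong_mono K q a) = central_mono a.
Proof. by move=> Ma; rewrite /central cong_val_mono // lin_extX. Qed.

Lemma fan_monoM c1 c2 : fan_mono c1 * fan_mono c2 =
  if `[< share_cone c1 c2 >] then fan_mono (c1 + c2) else 0.
Proof. by rewrite [LHS]fan_mulU /fan_term mulr1. Qed.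

Lemma in_facet_min0 a j : cong_mnm q a -> mnm_min a = 0%N ->
  in_facet j (mnm_class p a) <-> a j = 0%N.
Proof.
move=> Ma a0; rewrite in_facet_mnm_class //; split=> [le_a|-> //].
by have [i ai] := mnm_minP a; apply/eqP; rewrite -leqn0 -a0 -ai.
Qed.

(** A product of two monomials that are not divisible by t is divisible by t
    exactly when they vanish at no common coordinate, that is, when their
    classes lie in no common facet of the fan. *)
Lemma central_monoD a b : cong_mnm q a -> cong_mnm q b ->
  central_mono (a + b)%MM = central_mono a * central_mono b.
Proof.
move=> Ma Mb; rewrite /central_mono.
have [a0|a_neq0] := eqVneq (mnm_min a) 0%N; last first.
  rewrite mul0r ifN //; apply: (contraNN _ a_neq0); move/mnm_min_eq0P => [j].
  rewrite mnmDE => /eqP; rewrite addn_eq0 => /andP[/eqP aj _].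
  by apply/mnm_min_eq0P; exists j.
have [b0|b_neq0] := eqVneq (mnm_min b) 0%N; last first.
  rewrite mulr0 ifN //; apply: (contraNN _ b_neq0); move/mnm_min_eq0P => [j].
  rewrite mnmDE => /eqP; rewrite addn_eq0 => /andP[_ /eqP bj].
  by apply/mnm_min_eq0P; exists j.
rewrite fan_monoM mnm_classD //; congr (if _ then _ else _).
apply/mnm_min_eq0P/asboolP => [[j]|].
  rewrite mnmDE => /eqP; rewrite addn_eq0 => /andP[/eqP aj /eqP bj].
  by apply/(share_coneP p_gt0); exists j; rewrite !in_facet_min0.
move/(share_coneP p_gt0) => [j]; rewrite !in_facet_min0 // => -[aj bj].
by exists j; rewrite mnmDE aj bj.
Qed.

Lemma central1 : central 1 = 1.
Proof.
rewrite -cong_mono0 centralE ?cong_mnm0 // /central_mono mnm_min0 eqxx.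
by congr mono; apply: mnm_class0.
Qed.

Lemma centralM x y : central (x * y) = central x * central y.
Proof.
elim/cong_alg_ind: x => [|e a x Ma IHx]; first by rewrite mul0r central0 mul0r.
rewrite mulrDl !centralD mulrDl IHx; congr (_ + _); rewrite {IHx}.
elim/cong_alg_ind: y => [|f b y Mb IHy]; first by rewrite mulr0 central0 mulr0.
rewrite mulrDr !centralD mulrDr IHy; congr (_ + _); rewrite {IHy}.
rewrite -scalerAl -scalerAr !centralZ -scalerAl -scalerAr; congr (_ *: (_ *: _)).
rewrite -cong_monoD // (centralE (cong_mnmD Ma Mb)) (centralE Ma) (centralE Mb).
exact: central_monoD.
Qed.

Lemma central_zmod : zmod_morphism central.
Proof. by move=> x y; rewrite -[- y]scaleN1r centralD centralZ scaleN1r. Qed.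

Lemma central_monoid : monoid_morphism central.
Proof. by split; [exact: central1 | exact: centralM]. Qed.

HB.instance Definition _ := GRing.isZmodMorphism.Build B S central central_zmod.
HB.instance Definition _ := GRing.isScalable.Build K B S _ central centralZ.

(** Multiplicativity depends on gcd(p) = 1, which cannot be found from the
    function alone; hence a packed morphism instead of an inferred one. *)
Definition central_morphism : {lrmorphism B -> S} :=
  HB.pack central (GRing.isMonoidMorphism.Build B S central central_monoid).

Lemma central_surj (y : S) : exists x, central x = y.
Proof.
elim/fan_alg_ind: y => [|y z [x <-] [x' <-]|e c].
- by exists 0; rewrite central0.
- by exists (x + x'); rewrite centralD.
have [a [Ma a0 ac]] := mnm_class_surj p_gt0 p_gcd c.
exists (e *: cong_mono K q a); rewrite centralZ centralE // /central_mono a0 eqxx ac.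
by rewrite [LHS]monoZ mulr1.
Qed.

Definition fan_coef (c : Nlat p) (y : S) : K := monalg.mcoeff c y.

Lemma fan_coefD c (y z : S) : fan_coef c (y + z) = fan_coef c y + fan_coef c z.
Proof. exact: monalg.mcoeffD. Qed.

Lemma fan_coefZ c e (y : S) : fan_coef c (e *: y) = e * fan_coef c y.
Proof. exact: monalg.mcoeffZ. Qed.

Lemma fan_coef_mono c c' : fan_coef c (fan_mono c') = (c' == c)%:R.
Proof. by rewrite /fan_coef /fan_mono monoE monalg.mcoeffU. Qed.

(** The exponents with a vanishing coordinate are told apart by their classes, so
    no cancellation occurs. *)
Lemma central_coef x a : a \in msupp (val x) -> mnm_min a = 0%N ->
  fan_coef (mnm_class p a) (central x) = (val x)@_a.
Proof.
move=> ax a0; rewrite /central.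
rewrite (@lin_ext_functional _ _ _ _ _ _ (fan_coefD _) (fan_coefZ _)).
have coefE b : b \in msupp (val x) -> b != a ->
    fan_coef (mnm_class p a) (central_mono b) = 0.
  have M b' : b' \in msupp (val x) -> cong_mnm q b' by move: b'; apply/cong_polyP/valP.
  move=> bx b_neq_a; rewrite /central_mono; case: eqP => [b0|_]; last exact: monalg.mcoeff0.
  rewrite fan_coef_mono; case: eqP => [ba|//].
  by rewrite (mnm_class_inj p_gt0 p_gcd _ _ b0 a0 ba) ?M ?eqxx in b_neq_a.
rewrite (bigD1_seq a) //= ?msupp_uniq // big_seq_cond big1 => [|b /andP[bx ba]].
  by rewrite /central_mono a0 /= fan_coef_mono eqxx mulr1 addr0.
by rewrite coefE ?mulr0.
Qed.

Lemma central_param : central t = 0.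
Proof.
rewrite /base_param centralE ?cong_mnm_ones // /central_mono.
by rewrite (@mnm_minE _ _ 1) // => [|i]; [exists ord0|]; rewrite mnmE.
Qed.

Lemma central_eq0 x : central x = 0 <-> exists y, x = t * y.
Proof.
split=> [x0|[y ->]]; last by rewrite centralM central_param mul0r.
apply: cong_mono_dvd => // [|a ax]; first exact: cong_mnm_ones.
rewrite ones_le lt0n; apply/eqP => a0.
have := central_coef ax a0; rewrite x0 => /esym/eqP.
rewrite [X in _ == X]monalg.mcoeff0 => xa0.
by move: ax; rewrite mcoeff_msupp xa0.
Qed.

End CentralFibre.

(** * Vector fields along the fibres *)

Section CongruenceCancellation.
Variables (K : idomainType) (n : nat) (q : 'I_n.+1 -> nat).
Hypothesis q_gt0 : forall i, (0 < q i)%N.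
Local Notation B := (cong_alg K q).
Implicit Types (m : 'X_{1..n.+1}) (x y : B).

Lemma cong_mono_lreg m : cong_mnm q m -> injective (fun x => cong_mono K q m * x).
Proof.
move=> Mm x y /(congr1 val); rewrite !cong_valM !cong_val_mono // => E.
apply: val_inj; apply: mulfI E.
by rewrite -msupp_eq0 msuppX.
Qed.

(** Multiplying by a monomial in other variables does not help divisibility by
    z^m, as is read off from each exponent. *)
Lemma cong_mono_coprime_dvd m m' x y : cong_mnm q m -> cong_mnm q m' ->
  (forall i, m i = 0%N \/ m' i = 0%N) ->
  cong_mono K q m' * x = cong_mono K q m * y -> exists z, x = cong_mono K q m * z.
Proof.
move=> Mm Mm' mm' /(congr1 val); rewrite !cong_valM !cong_val_mono // => E.
apply: cong_mono_dvd => // a ax; apply/mnm_lepP => i.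
case: (mm' i) => [->//|m'i].
have : (m' + a)%MM \in msupp ('X_[m] * val y).
  by rewrite -E mcoeff_msupp mulrC mcoeffMX -mcoeff_msupp.
rewrite mulrC (perm_mem (msuppMX _ _)) => /mapP[b _ /mnmP/(_ i)].
by rewrite !mnmDE m'i add0n => ->; rewrite leq_addr.
Qed.

End CongruenceCancellation.

Section Derivations.
Variables (B : comPzRingType) (D : B -> B).
Hypothesis D_add : forall x y, D (x + y) = D x + D y.
Hypothesis D_mul : forall x y, D (x * y) = x * D y + D x * y.

Lemma derivation1 : D 1 = 0.
Proof.
by have := D_mul 1 1; rewrite !mulr1 mul1r => /(congr1 (+%R (- D 1))); rewrite addKr addNr.
Qed.

Lemma derivation0 : D 0 = 0.
Proof. by apply: (addrI (D 0)); rewrite -D_add !addr0. Qed.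

Lemma derivation_sum (I : Type) (r : seq I) (P : pred I) (F : I -> B) :
  D (\sum_(i <- r | P i) F i) = \sum_(i <- r | P i) D (F i).
Proof. exact: (big_morph D D_add derivation0). Qed.

(** D(y) / y = e / s, cleared of denominators. *)
Definition log_deriv_of (s y e : B) := s * D y = y * e.

Lemma log_deriv_of1 s : log_deriv_of s 1 0.
Proof. by rewrite /log_deriv_of derivation1 !mulr0. Qed.

Lemma log_deriv_ofM s y z e f :
  log_deriv_of s y e -> log_deriv_of s z f -> log_deriv_of s (y * z) (e + f).
Proof.
rewrite /log_deriv_of => ye zf; rewrite D_mul mulrDr mulrCA zf mulrA ye.
by rewrite mulrDr addrC -mulrA [e * z]mulrC !mulrA.
Qed.

Lemma log_deriv_ofX s y e k : log_deriv_of s y e -> log_deriv_of s (y ^+ k) (e *+ k).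
Proof.
move=> ye; elim: k => [|k IHk]; first exact: log_deriv_of1.
by rewrite exprS mulrS; apply: log_deriv_ofM.
Qed.

Lemma log_deriv_of_prod s (I : Type) (r : seq I) (y e : I -> B) (k : I -> nat) :
  (forall i, log_deriv_of s (y i) (e i)) ->
  log_deriv_of s (\prod_(i <- r) y i ^+ k i) (\sum_(i <- r) e i *+ k i).
Proof.
move=> ye; apply: big_rec2 => [|i f z _ zf]; first exact: log_deriv_of1.
by apply: log_deriv_ofM => //; apply: log_deriv_ofX.
Qed.

End Derivations.

Section LogarithmicDerivations.
Variables (K : numFieldType) (n : nat) (p : 'I_n.+1 -> nat).
Hypotheses (p_gt0 : forall i, (0 < p i)%N).
Local Notation q := (coweight p).
Local Notation d := (weight_prod p).
Local Notation B := (cong_alg K q).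
Local Notation t := (base_param K q).
Local Notation x_ := (@torus_coord K n p).
Let q_gt0 := coweight_gt0 p_gt0.

Variable D : B -> B.
Hypothesis D_rel : relative_derivation (@base_map K n q) D.

Let D_add x y : D (x + y) = D x + D y. Proof. by case: D_rel. Qed.
Let D_mul x y : D (x * y) = x * D y + D x * y. Proof. by case: D_rel. Qed.

Let D_base g x : D (base_map q g * x) = base_map q g * D x.
Proof. by case: D_rel => _ _; apply. Qed.

Lemma relative_deriv_param k : D (t ^+ k) = 0.
Proof.
have -> : t ^+ k = base_map q 'X^k * 1 by rewrite mulr1 base_mapXn // base_paramX.
by rewrite D_base (derivation1 D_mul) mulr0.
Qed.

(** (x_0 ... x_n) / x_j *)
Definition coord_prod_but j : B := \prod_(l | l != j) x_ l.

Lemma coord_prod_butM j : \prod_l x_ l = x_ j * coord_prod_but j.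
Proof. by rewrite (bigD1 j). Qed.

Lemma coord_prod_mono (P : pred 'I_n.+1) :
  \prod_(l | P l) x_ l = cong_mono K q (scale_mnm p [multinom (P i : nat) | i < n.+1]).
Proof.
rewrite -coord_prod big_mkcond; apply: eq_bigr => l _; rewrite mnmE.
by case: (P l).
Qed.

Lemma log_deriv_coord j :
  log_deriv_of D (\prod_l x_ l) (x_ j) (D (x_ j) * coord_prod_but j).
Proof. by rewrite /log_deriv_of (coord_prod_butM j) -mulrA [_ * D _]mulrC. Qed.

(** The logarithmic derivative of x^p = t^d, which vanishes since D is linear over
    K[t]. *)
Lemma log_deriv_weights : \sum_j (D (x_ j) * coord_prod_but j) *+ p j = 0.
Proof.
have := log_deriv_of_prod D_mul (index_enum 'I_n.+1) p log_deriv_coord.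
rewrite /log_deriv_of coord_prod_weights // relative_deriv_param mulr0.
rewrite base_paramX // => /esym E.
by apply: (cong_mono_lreg (cong_mnmMn d (cong_mnm_ones q_gt0))); rewrite mulr0.
Qed.

(** In the relation sum_l p_l D(x_l) (x_0 ... x_n) / x_l = 0 all terms with
    l <> j are divisible by x_j, hence so is p_j D(x_j) (x_0 ... x_n) / x_j, and
    the last factor does not involve z_j. *)
Lemma coord_dvd_deriv j : exists b, D (x_ j) = x_ j * b.
Proof.
have pj_neq0 : (p j)%:R != 0 :> K by rewrite pnatr_eq0 -lt0n.
pose G := \sum_(l | l != j) (D (x_ l) * \prod_(h | (h != l) && (h != j)) x_ h) *+ p l.
have EG : (D (x_ j) * coord_prod_but j) *+ p j = x_ j * - G.
  have := log_deriv_weights; rewrite (bigD1 j) //= => /eqP; rewrite addr_eq0 => /eqP ->.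
  rewrite mulrN mulr_sumr; congr (- _); apply: eq_bigr => l lj.
  by rewrite /coord_prod_but (bigD1 j) 1?eq_sym //= mulrCA mulrnAr.
pose m' := scale_mnm p [multinom ((i != j) : nat) | i < n.+1].
apply: (@cong_mono_coprime_dvd _ _ _ q_gt0 _ m' _ ((p j)%:R^-1 *: - G)).
- exact: cong_mnm_coord.
- exact: cong_mnm_scale.
- move=> i; rewrite coord_mnmE !mnmE; by case: eqVneq => _; [right|left].
rewrite -coord_prod_mono -scalerAr -[cong_mono _ _ _]/(x_ j) -EG mulrC.
by rewrite -scaler_nat scalerA mulVf // scale1r.
Qed.

(** Every vector field along the fibres is logarithmic, sum_j b_j x_j d/dx_j, and
    being tangent to the fibres of x^p means sum_j p_j b_j = 0. *)
Lemma relative_deriv_log : exists b : 'I_n.+1 -> B,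
  \sum_j b j *+ p j = 0 /\
  forall w : 'I_n.+1 -> nat,
    D (\sum_i x_ i ^+ w i) = \sum_i x_ i ^+ w i * (b i *+ w i).
Proof.
have /choice[b bE] := coord_dvd_deriv; exists b.
have lreg : injective (fun y : B => \prod_l x_ l * y).
  by rewrite coord_prod_mono; apply/cong_mono_lreg/cong_mnm_scale.
have E j : D (x_ j) * coord_prod_but j = \prod_l x_ l * b j.
  by rewrite bE (coord_prod_butM j) mulrAC.
split=> [|w].
  apply: lreg; rewrite /= mulr0 mulr_sumr -[RHS]log_deriv_weights.
  by apply: eq_bigr => j _; rewrite E mulrnAr.
rewrite (derivation_sum D_add); apply: eq_bigr => j _; apply: lreg => /=.
have := log_deriv_ofX D_mul (w j) (log_deriv_coord j); rewrite /log_deriv_of => ->.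
by rewrite E -mulrnAr mulrCA.
Qed.

End LogarithmicDerivations.

(** * The Jacobian ideal and the orbifold Chow ring *)

Section ToricDivisors.
Variables (n : nat) (p w : 'I_n.+1 -> nat).

Definition divisor_class i : Nlat p := beta p w (delta_mx 0 i).

Lemma lattice_class_natmul (v : 'rV[int]_n.+1) k :
  lattice_class p (v *+ k) = lattice_class p v *+ k.
Proof.
by elim: k => [|k IHk]; rewrite ?mulr0n ?lattice_class0 // !mulrS lattice_classD IHk.
Qed.

Lemma divisor_classE i : divisor_class i = lattice_class p (delta_mx 0 i *+ w i).
Proof.
rewrite /divisor_class /beta (bigD1 i) //= big1 => [|l /negPf li].
  by rewrite mxE !eqxx mul1r addr0 -pmulrn lattice_class_natmul.
by rewrite mxE eqxx li mul0r mulr0z.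
Qed.

Lemma mnm_class_coord (p_gt0 : forall i, (0 < p i)%N) i :
  \big[gcdn/0%N]_j p j = 1%N -> mnm_class p (coord_mnm p i *+ w i)%MM = divisor_class i.
Proof.
move=> p_gcd; have -> : (coord_mnm p i *+ w i = scale_mnm p (U_(i) *+ w i))%MM.
  by apply/mnmP => j; rewrite mulmnE coord_mnmE mnmE mulmnE mnm1E mulnAC.
rewrite mnm_class_scale // divisor_classE; congr lattice_class; apply/matrixP => o j.
rewrite ord1 mulmxnE !mxE eqxx mulmnE mnm1E eq_sym.
by case: eqP => _; rewrite ?mul1n ?mul0n ?mul0rn //= pmulrn intz.
Qed.

End ToricDivisors.

Section Xi.
Variables (K : comNzRingType) (n : nat) (p : 'I_n.+1 -> nat).
Hypothesis p_gt0 : forall i, (0 < p i)%N.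
Local Notation S := (fan_alg K p_gt0).
Variable theta : {additive Nlat p -> int}.

Lemma fan_coefP (y z : S) : (forall c, fan_coef c y = fan_coef c z) -> y = z.
Proof. by move=> yz; apply/monalg.malgP. Qed.

Lemma xi_coef (y : S) c : fan_coef c (xi theta y : S) = (theta c)%:~R * fan_coef c y.
Proof.
have f0 : fan_coef c (0 : S) = 0 by exact: monalg.mcoeff0.
rewrite /xi (big_morph _ (fan_coefD c) f0).
have E c' e : fan_coef c (mono e c' : S) = e *+ (c' == c).
  by rewrite /fan_coef monoE monalg.mcoeffU.
under eq_bigr do rewrite E.
have [cy|cy] := boolP (c \in monalg.msupp y); last first.
  rewrite big_seq_cond big1 => [|c' /andP[c'y _]].
    by rewrite /fan_coef (monalg.mcoeff_outdom cy) mulr0.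
  by case: eqP cy => // <-; rewrite c'y.
rewrite (bigD1_seq c) ?fset_uniq //= eqxx mulr1n big1 ?addr0 // => c' /negPf ->.
by [].
Qed.

Lemma xiD (y z : S) : xi theta (y + z) = xi theta y + xi theta z :> S.
Proof. by apply: fan_coefP => c; rewrite fan_coefD !xi_coef fan_coefD mulrDr. Qed.

Lemma xi_mono c : xi theta (fan_mono K p_gt0 c) = fan_mono K p_gt0 c *~ theta c :> S.
Proof.
apply: fan_coefP => c'; rewrite -scaler_int fan_coefZ !xi_coef !fan_coef_mono.
by case: eqP => [->|_]; rewrite ?mulr0.
Qed.

Lemma xi_sum (I : Type) (r : seq I) (F : I -> Nlat p) :
  xi theta (\sum_(i <- r) fan_mono K p_gt0 (F i)) =
  \sum_(i <- r) fan_mono K p_gt0 (F i) *~ theta (F i) :> S.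
Proof.
have xi0 : xi theta (0 : S) = 0 :> S.
  by apply: (addrI (xi theta (0 : S) : S)); rewrite -xiD !addr0.
by rewrite (big_morph _ xiD xi0); apply: eq_bigr => i _; apply: xi_mono.
Qed.

End Xi.

Section Jacobian.
Variables (K : numFieldType) (n : nat) (p w : 'I_n.+1 -> nat).
Hypotheses (p_gt0 : forall i, (0 < p i)%N) (p_gcd : \big[gcdn/0%N]_j p j = 1%N).
Hypothesis n_gt0 : (0 < n)%N.
Local Notation q := (coweight p).
Local Notation B := (cong_alg K q).
Local Notation t := (base_param K q).
Local Notation S := (fan_alg K p_gt0).
Local Notation x_ := (@torus_coord K n p).
Local Notation Y_ i := (fan_mono K p_gt0 (divisor_class p w i)).
Let q_gt0 := coweight_gt0 p_gt0.

Definition potential : B := \sum_i x_ i ^+ w i.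

(** Since n > 0, the exponent of x_i vanishes at some coordinate, so x_i^(w_i)
    survives in the central fibre. *)
Lemma central_coord i : central p_gt0 (x_ i ^+ w i) = Y_ i.
Proof.
have Mi := cong_mnm_coord p i; have Mw := cong_mnmMn (w i) Mi.
rewrite cong_monoX // centralE //.
rewrite /central_mono mnm_class_coord // ifT //; apply/mnm_min_eq0P.
exists (if i == ord0 then ord_max else ord0); rewrite mulmnE coord_mnmE.
have [->|i_neq0] := eqVneq i ord0; last by rewrite (negPf i_neq0).
by rewrite -val_eqE /= ltn_eqF.
Qed.

Section Euler.
Variable theta : {additive Nlat p -> int}.

(** The logarithmic vector field of a linear form on N. *)
Definition euler (x : B) : B :=
  lin_ext (fun a => cong_mono K q a *~ theta (mnm_class p a)) (val x).

Lemma eulerD x y : euler (x + y) = euler x + euler y.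
Proof. by rewrite /euler cong_valD raddfD. Qed.

Lemma eulerZ e x : euler (e *: x) = e *: euler x.
Proof. by rewrite /euler cong_valZ linearZ. Qed.

Lemma eulerE a : cong_mnm q a ->
  euler (cong_mono K q a) = cong_mono K q a *~ theta (mnm_class p a).
Proof. by move=> Ma; rewrite /euler cong_val_mono // lin_extX. Qed.

Lemma eulerM x y : euler (x * y) = x * euler y + euler x * y.
Proof.
have euler0 : euler 0 = 0 by rewrite -[X in euler X](scale0r (0 : B)) eulerZ scale0r.
elim/cong_alg_ind: x => [|e a x Ma IHx]; first by rewrite !mul0r euler0 mul0r addr0.
rewrite !mulrDl !eulerD IHx mulrDl addrACA; congr (_ + _); rewrite {IHx}.
elim/cong_alg_ind: y => [|f b y Mb IHy]; first by rewrite !mulr0 euler0 !mulr0 addr0.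
rewrite !mulrDr !eulerD IHy mulrDr addrACA; congr (_ + _); rewrite {IHy}.
rewrite !eulerZ -!scalerAl -!scalerAr !eulerZ -!scalerDr; congr (_ *: (_ *: _)).
rewrite -cong_monoD // !eulerE ?cong_mnmD // mnm_classD // raddfD mulrzDr.
by rewrite cong_monoD // mulrzAr mulrzAl addrC.
Qed.

Lemma euler_relative : relative_derivation (@base_map K n q) euler.
Proof.
split; [exact: eulerD|exact: eulerM|move=> g x].
suff euler_base : euler (base_map q g) = 0.
  by rewrite eulerM euler_base mul0r addr0.
have euler_t : euler t = 0.
  rewrite eulerE ?cong_mnm_ones //.
  have -> : ones n = (ones n + 0)%MM by rewrite addm0.
  by rewrite mnm_class_ones ?cong_mnm0 // mnm_class0 // raddf0 mulr0z.
have euler1 := derivation1 eulerM.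
elim/poly_ind: g => [|g c IHg].
  by rewrite /base_map rmorph0 (derivation0 eulerD).
rewrite /base_map rmorphD rmorphM /= -/(base_map q g) horner_algX horner_algC.
by rewrite eulerD eulerM euler_t IHg eulerZ euler1 mulr0 mul0r scaler0 !addr0.
Qed.

Lemma euler_potential : central p_gt0 (euler potential) =
  xi theta (\sum_i Y_ i).
Proof.
rewrite [RHS]xi_sum /potential (big_morph _ eulerD (derivation0 eulerD)).
rewrite raddf_sum; apply: eq_bigr => i _.
have Mi := cong_mnm_coord p i.
rewrite -central_coord cong_monoX // (eulerE (cong_mnmMn _ Mi)) mnm_class_coord //.
by rewrite raddfMz.
Qed.

End Euler.

Local Notation in_orb := (generated_ideal (@orb_chow_gens K n p p_gt0 w)).
Local Notation in_jac :=
  (generated_ideal (jacobian_gens (@base_map K n q) (vanishing_at 0) potential)).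

Lemma xi_in_orb theta : in_orb (xi theta (\sum_i Y_ i)).
Proof. by apply: generated_ideal_gen; exists theta. Qed.

Section TestFunctional.
Variable i : 'I_n.+1.

(** The linear form p_0 e_i^* - p_i e_0^* on Z^{n+1}, which vanishes on p.  For
    varying i these forms span all linear forms on N over the rationals. *)
Definition test_functional (c : Nlat p) : int :=
  (p ord0)%:Z * (repr c) 0 i - (p i)%:Z * (repr c) 0 ord0.

Lemma test_functionalE v : test_functional (lattice_class p v) =
  (p ord0)%:Z * v 0 i - (p i)%:Z * v 0 ord0.
Proof.
by have [k kE] := repr_lattice_class p v; rewrite /test_functional !kE; ring.
Qed.

Lemma test_functional_zmod : zmod_morphism test_functional.
Proof.
have D c1 c2 : test_functional (c1 + c2) = test_functional c1 + test_functional c2.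
  rewrite -(lattice_classK c1) -(lattice_classK c2) -lattice_classD.
  by rewrite !test_functionalE !mxE; ring.
by move=> c1 c2; apply: (addIr (test_functional c2)); rewrite -D !subrK.
Qed.

HB.instance Definition _ :=
  GRing.isZmodMorphism.Build (Nlat p) int test_functional test_functional_zmod.

Lemma xi_test_functional :
  xi test_functional (\sum_l Y_ l) =
  (Y_ i *+ w i) *+ p ord0 - (Y_ ord0 *+ w ord0) *+ p i :> S.
Proof.
have sumE h k : \sum_l Y_ l *~ (k%:Z * (delta_mx 0 l *+ w l : 'rV[int]_n.+1) 0 h) =
    (Y_ h *+ w h) *+ k.
  rewrite (bigD1 h) //= big1 ?addr0 => [|l /negPf lh].
    have -> : k%:Z * (delta_mx 0 h *+ w h : 'rV[int]_n.+1) 0 h = (w h * k)%:Z.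
      by rewrite mulmxnE mxE !eqxx natz PoszM mulrC -mulr_natr natz; congr (_ * _); lia.
    by rewrite -pmulrn mulrnA.
  by rewrite mulmxnE mxE eqxx eq_sym lh mul0rn mulr0 mulr0z.
rewrite xi_sum -!sumE -sumrB; apply: eq_bigr => l _.
by rewrite -mulrzBr divisor_classE; congr (_ *~ _); apply: test_functionalE.
Qed.

End TestFunctional.

Let central_sum (F : 'I_n.+1 -> B) :
  central p_gt0 (\sum_i F i) = \sum_i central p_gt0 (F i).
Proof. exact: raddf_sum. Qed.

Let central_natmul (x : B) k : central p_gt0 (x *+ k) = central p_gt0 x *+ k.
Proof. exact: raddfMn. Qed.

(** With D(x_i) = x_i b_i, p_0 D(f) is the combination with coefficients b_i of
    the values at f of the Euler fields of the [test_functional i]: the extra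
    terms p_i w_0 b_i x_0^(w_0) sum to zero. *)
Lemma deriv_potential_in_orb D : relative_derivation (@base_map K n q) D ->
  in_orb (central p_gt0 (D potential)).
Proof.
move=> D_rel; have [b [b_weights bE]] := relative_deriv_log p_gt0 D_rel.
have p0_neq0 : (p ord0)%:R != 0 :> K by rewrite pnatr_eq0 -lt0n.
have E : central p_gt0 (D potential) *+ p ord0 =
    \sum_i central p_gt0 (b i) * (xi (test_functional i) (\sum_l Y_ l) : S).
  under eq_bigr do rewrite xi_test_functional mulrBr.
  rewrite sumrB [X in _ - X](_ : _ = 0) ?subr0.
    rewrite bE central_sum -sumrMnl; apply: eq_bigr => i _.
    by rewrite centralM // central_coord central_natmul mulrnAr !mulrnAr mulrC.
  transitivity (central p_gt0 (\sum_j b j *+ p j) * (Y_ ord0 *+ w ord0)); last first.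
    by rewrite b_weights central0 mul0r.
  rewrite central_sum mulr_suml; apply: eq_bigr => i _.
  by rewrite central_natmul mulrnAl -mulrnAr.
have -> : central p_gt0 (D potential) =
    ((p ord0)%:R^-1)%:A * (central p_gt0 (D potential) *+ p ord0).
  by rewrite mulr_algl -scaler_nat scalerA mulVf ?scale1r.
rewrite E; apply: generated_idealMl; apply: generated_ideal_sum => i _.
by apply: generated_idealMl; apply: xi_in_orb.
Qed.

Lemma central_ideal x : in_orb (central p_gt0 x) <-> in_jac x.
Proof.
have param_jac y : in_jac (t * y).
  rewrite mulrC; apply/generated_idealMl/generated_ideal_gen; left.
  by exists 'X; [rewrite /vanishing_at hornerX | exact/esym/base_mapX].
split=> [|].
  suff lift z : in_orb z -> exists2 y, in_jac y & central p_gt0 y = z.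
    move=> /lift[y jac_y /eqP]; rewrite -subr_eq0 -raddfB => /eqP.
    move=> yx; have [z yxE] : exists z, y - x = t * z.
      by apply/(central_eq0 p_gt0 p_gcd).
    rewrite -[x](subKr y).
    by apply: generated_idealB => //; rewrite yxE.
  move: z; apply: generated_ideal_sub.
  - by exists 0; [exact: generated_ideal0|rewrite raddf0].
  - move=> _ _ [y jac_y <-] [z jac_z <-]; exists (y + z); first exact: generated_idealD.
    by rewrite raddfD.
  move=> a z [theta ->]; have [a' <-] := central_surj p_gcd a.
  exists (a' * euler theta potential); last by rewrite centralM // euler_potential.
  apply/generated_idealMl/generated_ideal_gen; right.
  by exists (euler theta) => //; apply: euler_relative.
move: x; apply: generated_ideal_sub.
- by rewrite raddf0; apply: generated_ideal0.
- by move=> x y cx cy; rewrite centralD; apply: (generated_idealD cx cy).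
move=> a x [[g /eqP/factor_theorem[h gE] xE]|[D D_rel ->]].
  have -> : x = t * base_map q h.
    transitivity (base_map q g); first exact: xE.
    by rewrite gE subr0 mulrC /base_map rmorphM /= -/(base_map q h) horner_algX.
  by rewrite !centralM // central_param // mul0r mulr0; apply: generated_ideal0.
by rewrite centralM //; apply/generated_idealMl/deriv_potential_in_orb.
Qed.

Lemma jacobian_orb_chow :
  exists phi : {rmorphism jacobian_algebra (@base_map K n q) (vanishing_at 0) potential
                -> orb_chow K p_gt0 w}, alg_isomorphism phi.
Proof.
have [y|phi [phi_iso _]] :=
    @quot_map_iso K B S _ _ (central_morphism K p_gt0 p_gcd) central_ideal.
  have [x <-] := central_surj p_gcd y.
  by exists x; rewrite subrr; apply: generated_ideal0.
by exists phi.
Qed.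

End Jacobian.

(** * The mirror fibration *)

(** For n = 0 the condition reads gcd of the empty family = 1, that is
    0 = 1. *)
Lemma well_formed_gcd (n : nat) (p : 'I_n.+1 -> nat) :
  well_formed p -> (0 < n)%N /\ \big[gcdn/0%N]_j p j = 1%N.
Proof.
move=> p_wf; split.
  case: n p p_wf => // p /(_ ord0); rewrite big1 // => j.
  by rewrite (ord1 j) eqxx.
by rewrite (bigD1 ord0) //= p_wf gcdn1.
Qed.

(** Take c_i = s^(W / w_i) with W = w_0 ... w_n, so that every c_i^(w_i) is s^W;
    then s is a root of sigma of order sum_i p_i W / w_i. *)
Lemma torus_scaling (K : numClosedFieldType) (n : nat) (p w : 'I_n.+1 -> nat) (sigma : K) :
  (forall i, 0 < p i)%N -> (forall i, 0 < w i)%N -> sigma != 0 ->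
  exists lam (c : 'I_n.+1 -> K),
    [/\ lam != 0, \prod_i c i ^+ p i = sigma & forall i, c i ^+ w i = lam].
Proof.
move=> p_gt0 w_gt0 sigma_neq0.
pose e := (\sum_i coweight w i * p i)%N.
have e_gt0 : (0 < e)%N.
  by rewrite /e (bigD1 ord0) //= addn_gt0 muln_gt0 coweight_gt0 ?p_gt0.
pose s := e.-root sigma.
have s_e : s ^+ e = sigma by rewrite rootCK.
have s_neq0 : s != 0 by apply: contraNneq sigma_neq0 => s0; rewrite -s_e s0 expr0n gtn_eqF.
exists (s ^+ weight_prod w), (fun i => s ^+ coweight w i); split.
- exact: expf_neq0.
- by rewrite -s_e /e expr_sum; apply: eq_bigr => i _; rewrite exprM.
- by move=> i; rewrite -exprM coweightM.
Qed.

Theorem theorem1p1 (R : realType) (n : nat) (p : 'I_n.+1 -> nat)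
    (p_gt0 : forall i, (0 < p i)%N) (p_wf : well_formed p) :
  exists (A B : comAlgType R[i]) (pi : {lrmorphism A -> B}) (m0 : A -> Prop),
    [/\ rational_curve A, fibration pi, maximal_ideal m0
      & forall w : 'I_n.+1 -> nat, (forall i, (0 < w i)%N) ->
        exists f : B,
          [/\ forall m : A -> Prop, maximal_ideal m -> m <> m0 ->
                exists2 lam : R[i], lam != 0 & fibre_is_torus pi p w f m lam,
              exists m : A -> Prop,
                [/\ maximal_ideal m, m <> m0 & fibre_is_torus pi p w f m 1]
            & exists phi : {rmorphism jacobian_algebra pi m0 f
                                      -> orb_chow R[i] p_gt0 w},
                alg_isomorphism phi]].
Proof.
have [n_gt0 p_gcd] := well_formed_gcd p_wf.
have q_gt0 := coweight_gt0 p_gt0.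
exists ({poly R[i]} : comAlgType R[i]), (cong_alg R[i] (coweight p) : comAlgType R[i]).
exists (@base_map R[i] n (coweight p)), (vanishing_at 0); split.
- exact: poly_rational_curve.
- split; [exact: poly_finite_type|exact: cong_alg_finite_type|exact: base_map_flat].
- exact: vanishing_at_maximal.
move=> w w_gt0; exists (potential R[i] p w); split.
- move=> m /maximal_ideal_vanishing[tau ->] tau_neq.
  have tau_neq0 : tau != 0 by apply: contra_notN tau_neq => /eqP ->.
  have [lam [c [lam_neq0 c_p c_w]]] :=
    torus_scaling p_gt0 w_gt0 (expf_neq0 (weight_prod p) tau_neq0).
  by exists lam => //; apply: (fibre_torus p_gt0 p_gcd tau_neq0 c_p lam_neq0 c_w).
- exists (vanishing_at 1); split; first exact: vanishing_at_maximal.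
    move=> /(congr1 (fun m => m 'X)); rewrite /vanishing_at !hornerX => E.
    by have /eqP := oner_neq0 R[i]; apply; rewrite E.
  apply: (fibre_torus p_gt0 p_gcd (oner_neq0 R[i]) (c := fun=> 1) _ (oner_neq0 R[i])).
    by rewrite expr1n big1 // => i _; rewrite expr1n.
  by move=> i; rewrite expr1n.
exact: jacobian_orb_chow.
Qed.
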